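(* Let $n\neq-2,-1$ and $\mu=\frac{3n+4}{n+2}$. The point transformation $$x'=v,\qquad t'=t,\qquad u'=x^{-\frac{2}{n+2}}u^{-1},\qquad v'=\frac{n+2}{2(n+1)}x^{\frac{2(n+1)}{n+2}}$$ leads to the contact transformation $$\mathrm{d}x'=ux\,\mathrm{d}x+(xu)_x\,\mathrm{d}t,\qquad \mathrm{d}t'=\mathrm{d}t,\qquad u'=x^{-\frac{2}{n+2}}u^{-1},$$ which connects the nonlinear diffusion equation $$u'_{t'}=\left({u'}^{-(n+2)}u'_{x'}\right)_{x'}$$ and the equation $$u_t=\left(u^nu_x\right)_x+\frac{\mu}{x}u^nu_x .$$ In particular, if $n=0$, this contact transformation maps the nonlinear diffusion equation $u'_{t'}=\left({u'}^{-2}u'_{x'}\right)_{x'}$ into the linear equation $u_t=u_{xx}+\frac{2}{x}u_x$.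
   Context: Subscripts denote partial derivatives and $\mathrm d$ denotes the differential; $n$ is a constant, $u,v$ are functions of $(x,t)$, and $u',v'$ are functions of $(x',t')$. The stated point transformation maps the system $v'_{x'}=u'$, $v'_{t'}={u'}^{-(n+2)}u'_{x'}$ (the potential form of the diffusion equation) into the system $v_x=ux$, $v_t=xu^nu_x+\frac{\mu-1}{n+1}u^{n+1}$ (the potential form of the equation for $u$), with $\mu=\frac{3n+4}{n+2}$.
   Formalization: For n≠0 the printed dt-coefficient (xu)_x is false (n=1, u=1) and is replaced by v_t = x u^n u_x + (μ-1)/(n+1) u^{n+1}; for n=0 it is kept as printed. x, u, u' are taken positive for general n and nonzero in the n=0 equations. *)

(* Defs.v *)
From Stdlib Require Import Reals.
From Coquelicot Require Import Coquelicot.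

Open Scope R_scope.

(* The exponents are arbitrary real numbers, so powers are [Rpower], and the
   quantities raised to a power (x, u and u') are required to be positive as
   long as n is arbitrary.  Solutions are classical (of class C^2) on an open
   subset of the plane; regions vary, so existence statements are local. *)

Definition region : Type := R * R -> Prop.
Definition field : Type := R -> R -> R.

Definition D1 (f : field) : field := fun x t => Derive (fun y => f y t) x.
Definition D2 (f : field) : field := fun x t => Derive (fun s => f x s) t.

Definition C2_on (D : region) (f : field) : Prop :=
  forall x t, D (x, t) -> ex_diff_n f 2 x t.

(* u_t = (u^n u_x)_x + (mu / x) u^n u_x *)
Definition radial_diffusion (n mu : R) (D : region) (u : field) : Prop :=
  C2_on D u /\
  forall x t, D (x, t) ->
    0 < x /\ 0 < u x t /\
    D2 u x t = D1 (fun y s => Rpower (u y s) n * D1 u y s) x t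
               + mu / x * (Rpower (u x t) n * D1 u x t).

(* u'_t' = (u'^-(n+2) u'_x')_x' *)
Definition diffusion (n : R) (D' : region) (u' : field) : Prop :=
  C2_on D' u' /\
  forall x t, D' (x, t) ->
    0 < u' x t /\
    D2 u' x t = D1 (fun y s => Rpower (u' y s) (- (n + 2)) * D1 u' y s) x t.

(* x u^n u_x + (mu - 1) / (n + 1) u^(n+1) *)
Definition flux (n mu : R) (u : field) : field := fun x t =>
  x * Rpower (u x t) n * D1 u x t + (mu - 1) / (n + 1) * Rpower (u x t) (n + 1).

Definition radial_potential_system (n mu : R) (D : region) (w : field * field)
    : Prop :=
  let (u, v) := w in
  C2_on D u /\ C2_on D v /\
  forall x t, D (x, t) ->
    0 < x /\ 0 < u x t /\
    D1 v x t = u x t * x /\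
    D2 v x t = flux n mu u x t.

(* The potential v' is determined by u' only up to an additive constant; the
   second inequality says that v' takes its values in the range of
   x |-> (n+2) / (2(n+1)) x^(2(n+1)/(n+2)) on x > 0, which can always be
   achieved locally by the choice of this constant. *)
Definition diffusion_potential_system (n : R) (D' : region) (w' : field * field)
    : Prop :=
  let (u', v') := w' in
  C2_on D' u' /\ C2_on D' v' /\
  forall x t, D' (x, t) ->
    0 < u' x t /\ 0 < 2 * (n + 1) / (n + 2) * v' x t /\
    D1 v' x t = u' x t /\
    D2 v' x t = Rpower (u' x t) (- (n + 2)) * D1 u' x t.

(* (x, t, u, v) |-> (x', t', u', v') *)
Definition point_transformation (n : R) (q : R * R * R * R) : R * R * R * R :=
  let '(x, t, u, v) := q in
  (v,
   t,
   Rpower x (- (2 / (n + 2))) * / u,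
   (n + 2) / (2 * (n + 1)) * Rpower x (2 * (n + 1) / (n + 2))).

Definition graph (D : region) (w : field * field) (q : R * R * R * R) : Prop :=
  let '(x, t, a, b) := q in
  D (x, t) /\ a = fst w x t /\ b = snd w x t.

(* (u', v') on D' is the image of (u, v) on D: the point transformation maps
   the graph of (u, v) onto the graph of (u', v'). *)
Definition point_image (n : R) (D : region) (w : field * field)
    (D' : region) (w' : field * field) : Prop :=
  (forall x t, D (x, t) -> 0 < x /\ 0 < fst w x t) /\
  forall q', graph D' w' q' <->
    exists q, graph D w q /\ q' = point_transformation n q.

(* u' on D' is obtained from x' = X, t' = T, u' = h on D, where
     dX = a dx + b dt  and  dT = dt. *)
Definition differential_image (a b h X T : field) (D D' : region) (u' : field)
    : Prop :=
  (forall x t, D (x, t) ->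
     differentiable_pt_lim X x t (a x t) (b x t) /\
     differentiable_pt_lim T x t 0 1) /\
  forall x' t' z,
    (D' (x', t') /\ z = u' x' t') <->
    exists x t, D (x, t) /\ x' = X x t /\ t' = T x t /\ z = h x t.

(* dx' = u x dx + (x u^n u_x + (mu - 1) / (n + 1) u^(n+1)) dt,  dt' = dt,
   u' = x^(-2/(n+2)) u^-1.  The coefficient of dt is v_t; for n = 0, mu = 2 it
   is (x u)_x. *)
Definition contact_image (n mu : R) (X T : field)
    (D : region) (u : field) (D' : region) (u' : field) : Prop :=
  (forall x t, D (x, t) -> 0 < x /\ 0 < u x t) /\
  differential_image
    (fun x t => u x t * x)
    (flux n mu u)
    (fun x t => Rpower x (- (2 / (n + 2))) * / u x t)
    X T D D' u'.

(* For n = 0 all exponents are integers, and x, u and u' need only be nonzero. *)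

(* u_t = u_xx + (2 / x) u_x *)
Definition linear_equation (D : region) (u : field) : Prop :=
  C2_on D u /\
  forall x t, D (x, t) ->
    x <> 0 /\ u x t <> 0 /\
    D2 u x t = D1 (D1 u) x t + 2 / x * D1 u x t.

(* u'_t' = (u'^-2 u'_x')_x' *)
Definition inverse_square_diffusion (D' : region) (u' : field) : Prop :=
  C2_on D' u' /\
  forall x t, D' (x, t) ->
    u' x t <> 0 /\
    D2 u' x t = D1 (fun y s => / (u' y s) ^ 2 * D1 u' y s) x t.

(* dx' = u x dx + (x u)_x dt,  dt' = dt,  u' = x^-1 u^-1 *)
Definition contact_image0 (X T : field)
    (D : region) (u : field) (D' : region) (u' : field) : Prop :=
  (forall x t, D (x, t) -> x <> 0 /\ u x t <> 0) /\
  differential_image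
    (fun x t => u x t * x)
    (D1 (fun y s => y * u y s))
    (fun x t => / x * / u x t)
    X T D D' u'.

Definition subregion (D0 D : region) : Prop := forall p, D0 p -> D p.

(* The transformation given by the relation [image] connects the equations with
   solution predicates [sol] and [sol']: related functions are solutions
   simultaneously, and, near every point of its domain, every solution of
   either equation is related to some function. *)
Definition connects {S S' : Type}
    (image : region -> S -> region -> S' -> Prop)
    (sol : region -> S -> Prop) (sol' : region -> S' -> Prop) : Prop :=
  (forall D D' w w', open D -> open D' -> image D w D' w' ->
     (sol D w <-> sol' D' w')) /\
  (forall D w p, open D -> sol D w -> D p ->
     exists D0 D' w', open D0 /\ subregion D0 D /\ D0 p /\ open D' /\
       image D0 w D' w') /\
  (forall D' w' p', open D' -> sol' D' w' -> D' p' ->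
     exists D0' D w, open D0' /\ subregion D0' D' /\ D0' p' /\ open D /\
       image D w D0' w').

(* Main.v *)
Require Import Defs.
From Stdlib Require Import Reals.
From Coquelicot Require Import Coquelicot.
From Stdlib Require Import Lra Lia ClassicalEpsilon.

Open Scope R_scope.

(** The point transformation is a hodograph transformation: up to the
    reparametrization v' = height(x), it exchanges the unknown v with the
    independent variable x.  If v_x = u x, then v_x does not vanish, so
    (x, t) |-> (v(x, t), t) is locally invertible; its inverse
    (x', t') |-> (g, t') satisfies g_x' = 1 / (u x) and
    g_t' = - v_t / (u x).  As the derivative of the height is
    x weight(x), the function v' = height(g) has v'_x' = weight(x) / u = u'
    and v'_t' = - u' v_t.  Differentiating u' u = weight(x) with respect to x
    shows that - u' (x u^n u_x + (mu - 1) / (n + 1) u^(n+1)) is equal to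
    u'^-(n+2) u'_x' ([flux_relation]; this is where the exponents and mu have
    to fit together).  Hence the two potential systems correspond to each
    other ([hodograph_forward], [law_point_solutions]).

    Each second-order equation is the closedness condition of the differential
    form that its potential system prescribes ([radial_closed],
    [closed_of_potential]), and a closed form is locally exact
    ([local_potential]).  So the contact transformation connects the equations
    because the point transformation connects the systems.

    Two points need care.  The relation between u and u' assumes only that X is
    differentiable, and nothing of u itself; the regularity of u is recovered
    from that of u' ([hodograph_bootstrap]).  Moreover (x, t) |-> (X, T) need
    not be injective and T may differ from t by locally constant functions, so
    solutions are compared on small boxes, on which it is injective and T is a
    translation ([local_inverse], [time_translation]).

    The statements for arbitrary n on positive quantities and for n = 0 on
    nonzero quantities are two instances of one argument, for an abstract
    [law]. *)

(** * Open subsets of the plane *)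

Lemma open_locally_2d (D : region) (x t : R) :
  open D -> D (x, t) -> locally_2d (fun y s => D (y, s)) x t.
Proof.
  intros oD Dx; apply locally_2d_locally.
  apply filter_imp with (2 := oD _ Dx); now intros [y s].
Qed.

Lemma open_of_locally_2d (D : region) :
  (forall x t, D (x, t) -> locally_2d (fun y s => D (y, s)) x t) -> open D.
Proof.
  intros H [x t] Dx.
  apply filter_imp with (2 := proj1 (locally_2d_locally _ _ _) (H x t Dx)).
  now intros [y s].
Qed.

Definition box (x0 t0 d : R) : region :=
  fun p => Rabs (fst p - x0) < d /\ Rabs (snd p - t0) < d.

Lemma box_center (x t d : R) : 0 < d -> box x t d (x, t).
Proof.
  intros hd; split; simpl; rewrite Rminus_diag, Rabs_R0; exact hd.
Qed.

Lemma box_open (x0 t0 d : R) : open (box x0 t0 d).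
Proof.
  apply open_of_locally_2d; intros x t [hx ht]; simpl in hx, ht.
  assert (hp : 0 < Rmin (d - Rabs (x - x0)) (d - Rabs (t - t0)))
    by (apply Rmin_case; lra).
  exists (mkposreal _ hp); simpl; intros y s hy hs.
  split; simpl.
  - pose proof (Rmin_l (d - Rabs (x - x0)) (d - Rabs (t - t0))).
    replace (y - x0) with ((y - x) + (x - x0)) by ring.
    pose proof (Rabs_triang (y - x) (x - x0)); lra.
  - pose proof (Rmin_r (d - Rabs (x - x0)) (d - Rabs (t - t0))).
    replace (s - t0) with ((s - t) + (t - t0)) by ring.
    pose proof (Rabs_triang (s - t) (t - t0)); lra.
Qed.

Lemma box_in_open (D : region) (x t : R) :
  open D -> D (x, t) -> exists d, 0 < d /\ subregion (box x t d) D.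
Proof.
  intros oD Dx; destruct (open_locally_2d D x t oD Dx) as [d hd].
  exists d; split; [apply cond_pos|].
  intros [y s] [hy hs]; now apply hd.
Qed.

Lemma open_preimage (D : region) (f : field) (P : R -> Prop) :
  open D -> (forall x t, D (x, t) -> continuity_2d_pt f x t) -> open P ->
  open (fun q => D q /\ P (f (fst q) (snd q))).
Proof.
  intros oD Hf oP; apply open_of_locally_2d; intros x t [Dx Px]; simpl in Px.
  destruct (oP _ Px) as [e he].
  destruct (locally_2d_and _ _ _ _ (open_locally_2d D x t oD Dx) (Hf x t Dx e))
    as [d hd].
  exists d; intros y s hy hs; destruct (hd y s hy hs) as [h1 h2].
  split; [exact h1 | apply he, h2].
Qed.

(** * Functions of class C^k on an open set *)

(** Unlike [ex_diff_n], which is a condition at one point and separates the two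
    variables, this is differentiability of f as a function of two variables,
    which is what the chain rule needs; on open sets the two notions agree
    ([C2_on_class_C]). *)
Fixpoint class_C (k : nat) (D : region) (f : field) : Prop :=
  match k with
  | O => forall x t, D (x, t) -> continuity_2d_pt f x t
  | S k =>
      (forall x t, D (x, t) ->
         differentiable_pt_lim f x t (D1 f x t) (D2 f x t)) /\
      class_C k D (D1 f) /\ class_C k D (D2 f)
  end.

Lemma differentiable_pt_lim_D (f : field) (x t a b : R) :
  differentiable_pt_lim f x t a b -> D1 f x t = a /\ D2 f x t = b.
Proof. exact (differentiable_pt_lim_unique f x t a b). Qed.

Lemma differentiable_pt_lim_continuity (f : field) (x t a b : R) :
  differentiable_pt_lim f x t a b -> continuity_2d_pt f x t.
Proof. intros H; apply differentiable_continuity_pt; now exists a, b. Qed.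

Lemma differentiable_pt_lim_is_derive1 (f : field) (x t a b : R) :
  differentiable_pt_lim f x t a b -> is_derive (fun y => f y t) x a.
Proof.
  intros H; apply is_derive_Reals.
  replace a with (a * 1 + b * 0) by ring.
  apply (derivable_pt_lim_comp_2d f (fun y => y) (fun _ => t)).
  - exact H.
  - apply derivable_pt_lim_id.
  - apply derivable_pt_lim_const.
Qed.

Lemma differentiable_pt_lim_is_derive2 (f : field) (x t a b : R) :
  differentiable_pt_lim f x t a b -> is_derive (fun s => f x s) t b.
Proof.
  intros H; apply is_derive_Reals.
  replace b with (a * 0 + b * 1) by ring.
  apply (derivable_pt_lim_comp_2d f (fun _ => x) (fun s => s)).
  - exact H.
  - apply derivable_pt_lim_const.
  - apply derivable_pt_lim_id.
Qed.

Lemma class_C_sub (k : nat) (D D0 : region) (f : field) :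
  subregion D0 D -> class_C k D f -> class_C k D0 f.
Proof.
  intros hD; revert f; induction k as [|k IH]; simpl; intros f Hf.
  - intros x t Dx; apply Hf, hD, Dx.
  - destruct Hf as [Hd [H1 H2]]; repeat split; auto.
Qed.

Lemma class_C_pred (k : nat) (D : region) (f : field) :
  class_C (S k) D f -> class_C k D f.
Proof.
  revert f; induction k as [|k IH]; intros f [Hd [H1 H2]].
  - intros x t Dx; exact (differentiable_pt_lim_continuity _ _ _ _ _ (Hd x t Dx)).
  - split; [exact Hd|]; split; now apply IH.
Qed.

Lemma class_C_le (k j : nat) (D : region) (f : field) :
  (j <= k)%nat -> class_C k D f -> class_C j D f.
Proof.
  intros h; induction h as [|k h IH]; intros Hf; [exact Hf|].
  now apply IH, class_C_pred.
Qed.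

Lemma class_C_continuous (k : nat) (D : region) (f : field) :
  class_C k D f -> forall x t, D (x, t) -> continuity_2d_pt f x t.
Proof.
  induction k as [|k IH]; intros Hf; [exact Hf | now apply IH, class_C_pred].
Qed.

Lemma D1_ext_open (D : region) (f g : field) :
  open D -> (forall x t, D (x, t) -> f x t = g x t) ->
  forall x t, D (x, t) -> D1 f x t = D1 g x t.
Proof.
  intros oD E x t Dx; apply Derive_ext_loc.
  apply (locally_2d_1d_const_y (fun y s => f y s = g y s)).
  destruct (open_locally_2d D x t oD Dx) as [d hd]; exists d; intros; auto.
Qed.

Lemma D2_ext_open (D : region) (f g : field) :
  open D -> (forall x t, D (x, t) -> f x t = g x t) ->
  forall x t, D (x, t) -> D2 f x t = D2 g x t.
Proof.
  intros oD E x t Dx; apply Derive_ext_loc.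
  apply (locally_2d_1d_const_x (fun y s => f y s = g y s)).
  destruct (open_locally_2d D x t oD Dx) as [d hd]; exists d; intros; auto.
Qed.

Lemma differentiable_pt_lim_ext_open (D : region) (f g : field) (x t a b : R) :
  open D -> (forall y s, D (y, s) -> f y s = g y s) -> D (x, t) ->
  differentiable_pt_lim f x t a b -> differentiable_pt_lim g x t a b.
Proof.
  intros oD E Dx; apply differentiable_pt_lim_ext.
  destruct (open_locally_2d D x t oD Dx) as [d hd]; exists d; intros; auto.
Qed.

Lemma class_C_ext (k : nat) (D : region) (f g : field) :
  open D -> (forall x t, D (x, t) -> f x t = g x t) ->
  class_C k D f -> class_C k D g.
Proof.
  intros oD; revert f g; induction k as [|k IH]; intros f g E Hf.
  - intros x t Dx; apply continuity_2d_pt_ext_loc with f; [|now apply Hf].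
    destruct (open_locally_2d D x t oD Dx) as [d hd]; exists d; intros; auto.
  - destruct Hf as [Hd [H1 H2]].
    pose proof (D1_ext_open D f g oD E) as E1.
    pose proof (D2_ext_open D f g oD E) as E2.
    split; [|split; [now apply (IH (D1 f)) | now apply (IH (D2 f))]].
    intros x t Dx; rewrite <- E1, <- E2 by exact Dx.
    apply (differentiable_pt_lim_ext_open D f); auto.
Qed.

(** [D1 f] and [D2 f] agree with the exhibited partial derivatives a and b on D
    only, whence the need for D to be open. *)
Lemma class_C_intro (k : nat) (D : region) (f a b : field) :
  open D ->
  (forall x t, D (x, t) -> differentiable_pt_lim f x t (a x t) (b x t)) ->
  class_C k D a -> class_C k D b -> class_C (S k) D f.
Proof.
  intros oD Hd Ha Hb; split.
  - intros x t Dx; pose proof (Hd x t Dx) as H.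
    destruct (differentiable_pt_lim_D _ _ _ _ _ H) as [-> ->]; exact H.
  - split; [apply (class_C_ext k D a) | apply (class_C_ext k D b)]; auto;
      intros x t Dx; destruct (differentiable_pt_lim_D _ _ _ _ _ (Hd x t Dx));
      auto.
Qed.

Lemma class_C_const (k : nat) (D : region) (c : R) :
  open D -> class_C k D (fun _ _ => c).
Proof.
  intros oD; revert c; induction k as [|k IH]; intros c.
  - intros x t _; apply continuity_2d_pt_const.
  - apply (class_C_intro k D _ (fun _ _ => 0) (fun _ _ => 0)); auto.
    intros x t _.
    apply (differentiable_pt_lim_proj1_0 (fun _ => c)), derivable_pt_lim_const.
Qed.

Lemma differentiable_pt_lim_snd (x t : R) :
  differentiable_pt_lim (fun _ s => s) x t 0 1.
Proof.
  intros eps; exists eps; intros u v _ _.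
  replace (v - t - (0 * (u - x) + 1 * (v - t))) with 0 by ring.
  rewrite Rabs_R0; apply Rmult_le_pos; [apply Rlt_le, cond_pos|].
  apply Rle_trans with (2 := Rmax_l _ _), Rabs_pos.
Qed.

Lemma class_C_fst (k : nat) (D : region) : open D -> class_C k D (fun x _ => x).
Proof.
  intros oD; destruct k as [|k].
  - intros x t _; apply continuity_2d_pt_id1.
  - apply (class_C_intro k D _ (fun _ _ => 1) (fun _ _ => 0));
      auto using class_C_const.
    intros x t _.
    apply (differentiable_pt_lim_proj1_0 (fun x => x)), derivable_pt_lim_id.
Qed.

Lemma class_C_snd (k : nat) (D : region) : open D -> class_C k D (fun _ t => t).
Proof.
  intros oD; destruct k as [|k].
  - intros x t _; apply continuity_2d_pt_id2.
  - apply (class_C_intro k D _ (fun _ _ => 0) (fun _ _ => 1));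
      auto using class_C_const.
    intros x t _; apply differentiable_pt_lim_snd.
Qed.

Lemma differentiable_pt_lim_plus (f g : field) (x t a b a' b' : R) :
  differentiable_pt_lim f x t a b -> differentiable_pt_lim g x t a' b' ->
  differentiable_pt_lim (fun y s => f y s + g y s) x t (a + a') (b + b').
Proof.
  intros Hf Hg eps.
  assert (h2 : 0 < eps / 2) by (pose proof (cond_pos eps); lra).
  pose proof (locally_2d_and _ _ _ _ (Hf (mkposreal _ h2)) (Hg (mkposreal _ h2)))
    as [d hd].
  exists d; intros u v hu hv; destruct (hd u v hu hv) as [h1 h3].
  simpl in h1, h3.
  replace (f u v + g u v - (f x t + g x t)
           - ((a + a') * (u - x) + (b + b') * (v - t)))
    with ((f u v - f x t - (a * (u - x) + b * (v - t)))
          + (g u v - g x t - (a' * (u - x) + b' * (v - t)))) by ring.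
  apply Rle_trans with (1 := Rabs_triang _ _); lra.
Qed.

Lemma differentiable_pt_lim_prod (x t : R) :
  differentiable_pt_lim Rmult x t t x.
Proof.
  intros eps; exists eps; intros u v hu hv.
  replace (u * v - x * t - (t * (u - x) + x * (v - t)))
    with ((u - x) * (v - t)) by ring.
  rewrite Rabs_mult; apply Rmult_le_compat; try apply Rabs_pos.
  - lra.
  - apply Rmax_r.
Qed.

Lemma differentiable_pt_lim_mult (f g : field) (x t a b a' b' : R) :
  differentiable_pt_lim f x t a b -> differentiable_pt_lim g x t a' b' ->
  differentiable_pt_lim (fun y s => f y s * g y s) x t
    (a * g x t + f x t * a') (b * g x t + f x t * b').
Proof.
  intros Hf Hg.
  replace (a * g x t + f x t * a') with (g x t * a + f x t * a') by ring.
  replace (b * g x t + f x t * b') with (g x t * b + f x t * b') by ring.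
  apply (differentiable_pt_lim_comp Rmult f g); auto.
  apply differentiable_pt_lim_prod.
Qed.

Lemma class_C_plus (k : nat) (D : region) (f g : field) :
  open D -> class_C k D f -> class_C k D g ->
  class_C k D (fun x t => f x t + g x t).
Proof.
  intros oD; revert f g; induction k as [|k IH]; intros f g Hf Hg.
  - intros x t Dx; apply continuity_2d_pt_plus; [now apply Hf | now apply Hg].
  - destruct Hf as [Fd [F1 F2]], Hg as [Gd [G1 G2]].
    apply (class_C_intro k D _ (fun x t => D1 f x t + D1 g x t)
             (fun x t => D2 f x t + D2 g x t)); auto.
    intros x t Dx; apply differentiable_pt_lim_plus; auto.
Qed.

Lemma class_C_mult (k : nat) (D : region) (f g : field) :
  open D -> class_C k D f -> class_C k D g ->
  class_C k D (fun x t => f x t * g x t).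
Proof.
  intros oD; revert f g; induction k as [|k IH]; intros f g Hf Hg.
  - intros x t Dx; apply continuity_2d_pt_mult; [now apply Hf | now apply Hg].
  - pose proof (class_C_pred _ _ _ Hf) as Hf'.
    pose proof (class_C_pred _ _ _ Hg) as Hg'.
    destruct Hf as [Fd [F1 F2]], Hg as [Gd [G1 G2]].
    apply (class_C_intro k D _ (fun x t => D1 f x t * g x t + f x t * D1 g x t)
             (fun x t => D2 f x t * g x t + f x t * D2 g x t));
      auto using class_C_plus.
    intros x t Dx; apply differentiable_pt_lim_mult; auto.
Qed.

Lemma continuity_2d_pt_comp2 (f g h : field) (x t : R) :
  continuity_2d_pt f (g x t) (h x t) -> continuity_2d_pt g x t ->
  continuity_2d_pt h x t -> continuity_2d_pt (fun y s => f (g y s) (h y s)) x t.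
Proof.
  intros Hf Hg Hh eps; destruct (Hf eps) as [d hd].
  destruct (locally_2d_and _ _ _ _ (Hg d) (Hh d)) as [e he].
  exists e; intros u v hu hv; destruct (he u v hu hv); now apply hd.
Qed.

Lemma class_C_comp (k : nat) (D D' : region) (f g h : field) :
  open D -> class_C k D' f -> class_C k D g -> class_C k D h ->
  (forall x t, D (x, t) -> D' (g x t, h x t)) ->
  class_C k D (fun x t => f (g x t) (h x t)).
Proof.
  intros oD; revert f g h; induction k as [|k IH]; intros f g h Hf Hg Hh HD.
  - intros x t Dx; apply continuity_2d_pt_comp2; auto.
  - pose proof (class_C_pred _ _ _ Hg) as Hg'.
    pose proof (class_C_pred _ _ _ Hh) as Hh'.
    destruct Hf as [Fd [F1 F2]], Hg as [Gd [G1 G2]], Hh as [Hd [H1 H2]].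
    apply (class_C_intro k D _
      (fun x t => D1 f (g x t) (h x t) * D1 g x t
                  + D2 f (g x t) (h x t) * D1 h x t)
      (fun x t => D1 f (g x t) (h x t) * D2 g x t
                  + D2 f (g x t) (h x t) * D2 h x t)); auto.
    + intros x t Dx; apply differentiable_pt_lim_comp; auto.
    + apply class_C_plus; auto; apply class_C_mult; auto.
    + apply class_C_plus; auto; apply class_C_mult; auto.
Qed.

Lemma class_C_ex_diff_n (k : nat) (D : region) (f : field) :
  class_C k D f -> forall x t, D (x, t) -> ex_diff_n f k x t.
Proof.
  revert f; induction k as [|k IH]; intros f Hf x t Dx.
  - split; auto.
  - pose proof (class_C_continuous _ _ _ Hf x t Dx) as Hc.
    destruct Hf as [Hd [H1 H2]]; specialize (Hd x t Dx).
    split; [exact Hc|]; split; [|split; [|split; now apply IH]].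
    + eexists; exact (differentiable_pt_lim_is_derive1 _ _ _ _ _ Hd).
    + eexists; exact (differentiable_pt_lim_is_derive2 _ _ _ _ _ Hd).
Qed.

(** The increment of f is split into its increments along the two axes: the
    mean value theorem controls the first one, at the nearby time v, by the
    continuity of a; the second one is the derivative at (x, t) itself. *)
Lemma differentiable_pt_lim_of_partials (f a : field) (x t b : R) :
  locally_2d (fun y s => is_derive (fun z => f z s) y (a y s)) x t ->
  is_derive (fun s => f x s) t b ->
  continuity_2d_pt a x t ->
  differentiable_pt_lim f x t (a x t) b.
Proof.
  intros H1 H2 Ha eps.
  assert (h2 : 0 < eps / 2) by (pose proof (cond_pos eps); lra).
  apply is_derive_Reals in H2; destruct (H2 _ h2) as [d2 hd2].
  destruct (locally_2d_and _ _ _ _ H1 (Ha (mkposreal _ h2))) as [d1 hd1].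
  assert (hd : 0 < Rmin d1 d2) by (apply Rmin_case; apply cond_pos).
  exists (mkposreal _ hd); simpl; intros u v hu hv.
  pose proof (Rmin_l d1 d2) as ml; pose proof (Rmin_r d1 d2) as mr.
  destruct (MVT_cor4 (fun z => f z v) (fun z => a z v) x (Rabs (u - x)))
    with (b := u) as [c [Hc1 Hc2]]; [|lra|].
  { intros c hc; apply (hd1 c v); lra. }
  destruct (hd1 c v) as [_ Hc3]; [lra | lra |]; simpl in Hc3.
  assert (E2 : Rabs (f x v - f x t - b * (v - t)) <= eps / 2 * Rabs (v - t)).
  { destruct (Req_dec (v - t) 0) as [e|ne].
    - replace v with t by lra.
      replace (f x t - f x t - b * (t - t)) with 0 by ring.
      rewrite Rminus_diag, Rabs_R0; lra.
    - specialize (hd2 (v - t) ne ltac:(lra)).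
      replace (t + (v - t)) with v in hd2 by ring.
      replace (f x v - f x t - b * (v - t))
        with (((f x v - f x t) / (v - t) - b) * (v - t)) by (field; exact ne).
      rewrite Rabs_mult; apply Rmult_le_compat_r; [apply Rabs_pos | lra]. }
  replace (f u v - f x t - (a x t * (u - x) + b * (v - t)))
    with ((a c v - a x t) * (u - x) + (f x v - f x t - b * (v - t)))
    by lra.
  apply Rle_trans with (1 := Rabs_triang _ _); rewrite Rabs_mult.
  pose proof (Rmax_l (Rabs (u - x)) (Rabs (v - t))).
  pose proof (Rmax_r (Rabs (u - x)) (Rabs (v - t))).
  assert (Rabs (a c v - a x t) * Rabs (u - x) <= eps / 2 * Rabs (u - x))
    by (apply Rmult_le_compat_r; [apply Rabs_pos | lra]).
  nra.
Qed.

Lemma ex_diff_n_class_C (k : nat) (D : region) (f : field) :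
  open D -> (forall x t, D (x, t) -> ex_diff_n f k x t) -> class_C k D f.
Proof.
  intros oD; revert f; induction k as [|k IH]; intros f Hf.
  - intros x t Dx; apply Hf, Dx.
  - split; [|split; apply IH; intros x t Dx; apply Hf, Dx].
    intros x t Dx; apply differentiable_pt_lim_of_partials.
    + destruct (open_locally_2d D x t oD Dx) as [d hd].
      exists d; intros u v hu hv.
      apply Derive_correct, (Hf u v (hd u v hu hv)).
    + apply Derive_correct, Hf, Dx.
    + destruct (Hf x t Dx) as [_ [_ [_ [H _]]]].
      destruct k; exact (proj1 H).
Qed.

Lemma C2_on_class_C (D : region) (f : field) :
  open D -> C2_on D f <-> class_C 2 D f.
Proof.
  intros oD; split; intros H.
  - now apply ex_diff_n_class_C.
  - intros x t; now apply class_C_ex_diff_n.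
Qed.

(** * Smooth functions of one variable *)

(** A function of one variable is regarded as a field that does not depend on
    the second one, so that a single composition lemma serves both. *)
Definition smooth (P : R -> Prop) (f : R -> R) : Prop :=
  forall k, class_C k (fun p => P (fst p)) (fun y _ => f y).

Lemma open_fst (P : R -> Prop) : open P -> open (fun p : R * R => P (fst p)).
Proof.
  intros oP; apply open_of_locally_2d; intros x t Px.
  destruct (oP x Px) as [d hd]; exists d; intros y s hy _; exact (hd y hy).
Qed.

Lemma class_C_smooth (k : nat) (D : region) (P : R -> Prop) (f : R -> R)
    (g : field) :
  open D -> smooth P f -> class_C k D g -> (forall x t, D (x, t) -> P (g x t)) ->
  class_C k D (fun x t => f (g x t)).
Proof.
  intros oD Hf Hg HP.
  apply (class_C_comp k D (fun p => P (fst p)) (fun y _ => f y) g (fun _ _ => 0));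
    auto using class_C_const.
Qed.

Lemma smooth_ex_derive (P : R -> Prop) (f : R -> R) (x : R) :
  smooth P f -> P x -> ex_derive f x.
Proof.
  intros Hf Px; destruct (Hf 1%nat) as [Hd _]; specialize (Hd x 0 Px).
  eexists; exact (differentiable_pt_lim_is_derive1 _ _ _ _ _ Hd).
Qed.

Lemma differentiable_pt_lim_smooth (f : R -> R) (g : field) (x t l a b : R) :
  is_derive f (g x t) l -> differentiable_pt_lim g x t a b ->
  differentiable_pt_lim (fun y s => f (g y s)) x t (l * a) (l * b).
Proof.
  intros Hf Hg.
  replace (l * a) with (l * a + 0 * a) by ring.
  replace (l * b) with (l * b + 0 * b) by ring.
  apply (differentiable_pt_lim_comp (fun y _ => f y) g g); auto.
  apply differentiable_pt_lim_proj1_0, is_derive_Reals, Hf.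
Qed.

(** For functions whose derivative is an expression in the function itself, such
    as powers and the inverse: each order of regularity yields the next. *)
Lemma smooth_intro (P : R -> Prop) (f f' : R -> R) :
  open P -> (forall x, P x -> is_derive f x (f' x)) ->
  (forall k, class_C k (fun p => P (fst p)) (fun y _ => f y) ->
             class_C k (fun p => P (fst p)) (fun y _ => f' y)) ->
  smooth P f.
Proof.
  intros oP Hd Hs; pose proof (open_fst P oP) as oP2.
  assert (H : forall x t, P x -> differentiable_pt_lim (fun y _ => f y) x t (f' x) 0).
  { intros x t Px; apply differentiable_pt_lim_proj1_0, is_derive_Reals; auto. }
  intros k; induction k as [|k IH].
  - intros x t Px; exact (differentiable_pt_lim_continuity _ _ _ _ _ (H x t Px)).
  - apply (class_C_intro k _ _ (fun x _ => f' x) (fun _ _ => 0));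
      auto using class_C_const.
Qed.

Lemma open_neq0 : open (fun x : R => x <> 0).
Proof. apply open_neq. Qed.

Lemma open_pos : open (fun x : R => 0 < x).
Proof. apply open_gt. Qed.

Lemma smooth_const (P : R -> Prop) (c : R) : open P -> smooth P (fun _ => c).
Proof. intros oP k; apply class_C_const, open_fst, oP. Qed.

Lemma smooth_id (P : R -> Prop) : open P -> smooth P (fun x => x).
Proof. intros oP k; apply class_C_fst, open_fst, oP. Qed.

Lemma smooth_mult (P : R -> Prop) (f g : R -> R) :
  open P -> smooth P f -> smooth P g -> smooth P (fun x => f x * g x).
Proof. intros oP Hf Hg k; apply class_C_mult; auto using open_fst. Qed.

Lemma smooth_comp (P Q : R -> Prop) (f g : R -> R) :
  open P -> smooth Q f -> smooth P g -> (forall x, P x -> Q (g x)) ->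
  smooth P (fun x => f (g x)).
Proof.
  intros oP Hf Hg HQ k.
  apply (class_C_smooth k _ Q f (fun x _ => g x)); auto using open_fst.
Qed.

Lemma smooth_inv : smooth (fun x => x <> 0) Rinv.
Proof.
  apply (smooth_intro _ _ (fun x => -1 * (/ x * / x))).
  - exact open_neq0.
  - intros x hx; auto_derive; [exact hx | field; exact hx].
  - intros k Hk; pose proof (open_fst _ open_neq0) as oP.
    apply class_C_mult; auto using class_C_const, class_C_mult.
Qed.

Lemma is_derive_Rpower (a x : R) :
  0 < x -> is_derive (fun y => Rpower y a) x (a * Rpower x (a - 1)).
Proof.
  intros hx; apply is_derive_Reals, derivable_pt_lim_power; exact hx.
Qed.

Lemma smooth_Rpower (a : R) : smooth (fun x => 0 < x) (fun x => Rpower x a).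
Proof.
  apply (smooth_intro _ _ (fun x => a * (Rpower x a * / x))).
  - exact open_pos.
  - intros x hx.
    replace (a * (Rpower x a * / x)) with (a * Rpower x (a - 1)).
    + now apply is_derive_Rpower.
    + unfold Rminus; rewrite Rpower_plus, Rpower_Ropp, Rpower_1; auto.
  - intros k Hk; pose proof (open_fst _ open_pos) as oP.
    apply class_C_mult; auto using class_C_const; apply class_C_mult; auto.
    apply class_C_sub with (fun p : R * R => fst p <> 0); [|apply smooth_inv].
    intros p hp; lra.
Qed.

(** * Solving x' = X(x, t) for x *)

Lemma continuous_section1 (f : field) (x t : R) :
  continuity_2d_pt f x t -> continuous (fun y => f y t) x.
Proof.
  intros Hf; apply filterlim_locally; intros eps.
  exact (locally_2d_1d_const_y _ _ _ (Hf eps)).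
Qed.

Lemma continuous_section2 (f : field) (x t : R) :
  continuity_2d_pt f x t -> continuous (fun s => f x s) t.
Proof.
  intros Hf; apply filterlim_locally; intros eps.
  exact (locally_2d_1d_const_x _ _ _ (Hf eps)).
Qed.

(** The one-variable function x |-> X(x, t0) takes values on both sides of
    X(x0, t0) at x0 - r and x0 + r; by continuity this persists for nearby t,
    and the intermediate value theorem gives a solution between them. *)
Lemma solve_nearby (D : region) (X : field) (x0 t0 A B eps : R) :
  open D -> D (x0, t0) ->
  (forall x t, D (x, t) -> continuity_2d_pt X x t) ->
  differentiable_pt_lim X x0 t0 A B -> A <> 0 -> 0 < eps ->
  exists d, 0 < d /\ forall y t,
    Rabs (y - X x0 t0) < d -> Rabs (t - t0) < d ->
    exists x, Rabs (x - x0) < eps /\ D (x, t) /\ X x t = y.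
Proof.
  intros oD Dx HX HA hA heps.
  destruct (box_in_open D x0 t0 oD Dx) as [d0 [hd0 Hbox]].
  assert (pA : 0 < Rabs A) by (now apply Rabs_pos_lt).
  assert (h2 : 0 < Rabs A / 2) by lra.
  destruct (HA (mkposreal _ h2)) as [d1 Hd1]; simpl in Hd1.
  set (r := Rmin (Rmin d0 d1) eps / 2).
  assert (hr : 0 < r /\ r < d0 /\ r < d1 /\ r < eps).
  { unfold r; pose proof (cond_pos d1).
    pose proof (Rmin_l (Rmin d0 d1) eps); pose proof (Rmin_r (Rmin d0 d1) eps).
    pose proof (Rmin_l d0 d1); pose proof (Rmin_r d0 d1).
    assert (0 < Rmin (Rmin d0 d1) eps) by (repeat apply Rmin_case; lra).
    lra. }
  destruct hr as [hr [hr0 [hr1 hre]]].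
  assert (hA2 : A * A = Rabs A * Rabs A)
    by (rewrite <- Rabs_mult, Rabs_pos_eq; nra).
  assert (Hp : A * (X (x0 + r) t0 - X x0 t0) >= A * A * r / 2).
  { specialize (Hd1 (x0 + r) t0).
    replace (x0 + r - x0) with r in Hd1 by ring.
    rewrite Rminus_diag, Rabs_R0, (Rabs_pos_eq r), Rmax_left in Hd1 by lra.
    specialize (Hd1 ltac:(lra) (cond_pos d1)).
    set (e := X (x0 + r) t0 - X x0 t0 - (A * r + B * 0)) in Hd1.
    assert (He : Rabs (A * e) <= Rabs A * (Rabs A / 2 * r))
      by (rewrite Rabs_mult; apply Rmult_le_compat_l; lra).
    apply Rabs_le_between in He.
    replace (X (x0 + r) t0 - X x0 t0) with (e + A * r) by (unfold e; ring).
    nra. }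
  assert (Hm : A * (X (x0 - r) t0 - X x0 t0) <= - (A * A * r / 2)).
  { specialize (Hd1 (x0 - r) t0).
    replace (x0 - r - x0) with (- r) in Hd1 by ring.
    rewrite Rminus_diag, Rabs_R0, Rabs_Ropp, (Rabs_pos_eq r), Rmax_left in Hd1
      by lra.
    specialize (Hd1 ltac:(lra) (cond_pos d1)).
    set (e := X (x0 - r) t0 - X x0 t0 - (A * - r + B * 0)) in Hd1.
    assert (He : Rabs (A * e) <= Rabs A * (Rabs A / 2 * r))
      by (rewrite Rabs_mult; apply Rmult_le_compat_l; lra).
    apply Rabs_le_between in He.
    replace (X (x0 - r) t0 - X x0 t0) with (e - A * r) by (unfold e; ring).
    nra. }
  assert (hm : 0 < Rabs A * r / 8) by nra.
  assert (Dp : forall s, Rabs s <= r -> forall t, Rabs (t - t0) < d0 -> D (x0 + s, t)).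
  { intros s hs t ht; apply Hbox; split; simpl; [|exact ht].
    replace (x0 + s - x0) with s by ring; lra. }
  destruct (HX (x0 + r) t0) with (eps := mkposreal _ hm) as [d2 Hd2].
  { apply Dp; [rewrite Rabs_pos_eq; lra | rewrite Rminus_diag, Rabs_R0; lra]. }
  destruct (HX (x0 - r) t0) with (eps := mkposreal _ hm) as [d3 Hd3].
  { apply (Dp (- r)); [rewrite Rabs_Ropp, Rabs_pos_eq; lra
                      | rewrite Rminus_diag, Rabs_R0; lra]. }
  simpl in Hd2, Hd3.
  set (d := Rmin (Rmin d0 (Rabs A * r / 8)) (Rmin d2 d3)).
  assert (hd : 0 < d /\ d <= d0 /\ d <= Rabs A * r / 8 /\ d <= d2 /\ d <= d3).
  { unfold d; pose proof (cond_pos d2); pose proof (cond_pos d3).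
    pose proof (Rmin_l (Rmin d0 (Rabs A * r / 8)) (Rmin d2 d3)).
    pose proof (Rmin_r (Rmin d0 (Rabs A * r / 8)) (Rmin d2 d3)).
    pose proof (Rmin_l d0 (Rabs A * r / 8)); pose proof (Rmin_r d0 (Rabs A * r / 8)).
    pose proof (Rmin_l d2 d3); pose proof (Rmin_r d2 d3).
    split; [repeat apply Rmin_case; auto | lra]. }
  destruct hd as [hd [h0 [h1 [h3 h4]]]].
  exists d; split; [exact hd|]; intros y t hy ht.
  specialize (Hd2 (x0 + r) t).
  rewrite Rminus_diag, Rabs_R0 in Hd2; specialize (Hd2 (cond_pos d2) ltac:(lra)).
  specialize (Hd3 (x0 - r) t).
  rewrite Rminus_diag, Rabs_R0 in Hd3; specialize (Hd3 (cond_pos d3) ltac:(lra)).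
  (* Multiplication by A makes the function increasing across x0, whatever the
     sign of A. *)
  assert (small : forall e, Rabs e < Rabs A * r / 8 ->
                  - (A * A * r / 8) < A * e < A * A * r / 8).
  { intros e he; apply and_comm, Rabs_def2.
    rewrite Rabs_mult, hA2; nra. }
  pose proof (small _ Hd2); pose proof (small _ Hd3).
  pose proof (small (y - X x0 t0) ltac:(lra)).
  assert (0 < A * A * r) by nra.
  assert (Hcont : forall x, x0 - r <= x <= x0 + r ->
                  continuity_pt (fun z => A * X z t) x).
  { intros x hx.
    assert (Dxt : D (x, t)).
    { replace x with (x0 + (x - x0)) by ring; apply Dp; [apply Rabs_le|]; lra. }
    apply continuity_pt_mult; [apply continuity_pt_const; intros a b; reflexivity|].
    apply continuity_pt_filterlim, continuous_section1, HX, Dxt. }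
  destruct (IVT_Rbar_incr (fun z => A * X z t) (x0 - r) (x0 + r)
              (A * X (x0 - r) t) (A * X (x0 + r) t) (A * y)) as [x [hx1 [hx2 hx3]]].
  - apply (is_lim_continuity (fun z => A * X z t)), Hcont; lra.
  - apply (is_lim_continuity (fun z => A * X z t)), Hcont; lra.
  - simpl; intros x hx1 hx2; apply Hcont; lra.
  - simpl; lra.
  - simpl; split; nra.
  - simpl in hx1, hx2; exists x; split; [|split].
    + apply Rabs_def1; lra.
    + replace x with (x0 + (x - x0)) by ring; apply Dp; [apply Rabs_le|]; lra.
    + now apply Rmult_eq_reg_l with A.
Qed.

(** If g inverts X in its first argument, the displacement dx of g satisfies
    |dy - A dx - B dt| <= e max(|dx|, |dt|) with e <= |A| / 2, which bounds dx
    by a multiple of max(|dy|, |dt|); dividing by A then turns this inequality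
    into the differentiability of g. *)
Lemma differentiable_pt_lim_inverse (D : region) (X g : field)
    (c x0 t0 A B : R) :
  open D -> D (x0, t0) ->
  (forall x t, D (x, t) -> continuity_2d_pt X x t) ->
  (forall x t, D (x, t) -> g (X x t) (t + c) = x) ->
  differentiable_pt_lim X x0 t0 A B -> A <> 0 ->
  differentiable_pt_lim g (X x0 t0) (t0 + c) (/ A) (- B / A).
Proof.
  intros oD Dx HX Hg HA hA eps.
  assert (pA : 0 < Rabs A) by (now apply Rabs_pos_lt).
  set (K := 2 / Rabs A + 2 * Rabs B / Rabs A + 1).
  assert (hK : 1 <= K).
  { unfold K; assert (0 < 2 / Rabs A) by (apply Rdiv_lt_0_compat; lra).
    assert (0 <= 2 * Rabs B / Rabs A)
      by (apply Rdiv_le_0_compat; [pose proof (Rabs_pos B); lra | lra]).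
    lra. }
  set (e := Rmin (Rabs A / 2) (eps * Rabs A / K)).
  assert (he : 0 < e).
  { unfold e; apply Rmin_case; [lra|].
    apply Rdiv_lt_0_compat; [|lra]; apply Rmult_lt_0_compat; auto.
    apply cond_pos. }
  destruct (HA (mkposreal e he)) as [d1 Hd1]; simpl in Hd1.
  destruct (solve_nearby D X x0 t0 A B d1 oD Dx HX HA hA (cond_pos d1))
    as [d2 [hd2 Hd2]].
  assert (hd : 0 < Rmin d1 d2) by (apply Rmin_case; [apply cond_pos | exact hd2]).
  exists (mkposreal _ hd); simpl; intros y s hy hs.
  pose proof (Rmin_l d1 d2); pose proof (Rmin_r d1 d2).
  assert (hs' : Rabs (s - c - t0) < Rmin d1 d2)
    by (replace (s - c - t0) with (s - (t0 + c)) by ring; exact hs).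
  destruct (Hd2 y (s - c)) as [x [hx [Dxs Ex]]]; [lra | lra |].
  assert (Eg : g y s = x).
  { rewrite <- Ex; replace s with (s - c + c) at 2 by ring; now apply Hg. }
  rewrite Eg, (Hg x0 t0 Dx).
  specialize (Hd1 x (s - c) hx ltac:(lra)); rewrite Ex in Hd1.
  replace (s - c - t0) with (s - (t0 + c)) in Hd1 by ring.
  set (dy := y - X x0 t0) in *; set (dt := s - (t0 + c)) in *.
  set (dx := x - x0) in *.
  set (m := Rmax (Rabs dy) (Rabs dt)).
  assert (my : Rabs dy <= m) by apply Rmax_l.
  assert (mt : Rabs dt <= m) by apply Rmax_r.
  assert (e1 : e <= Rabs A / 2) by apply Rmin_l.
  assert (e2 : e * K <= eps * Rabs A).
  { apply Rmult_le_reg_r with (/ K); [apply Rinv_0_lt_compat; lra|].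
    replace (e * K * / K) with e by (field; lra); apply Rmin_r. }
  assert (hM : Rmax (Rabs dx) (Rabs dt) <= Rabs dx + Rabs dt).
  { pose proof (Rabs_pos dx); pose proof (Rabs_pos dt).
    apply Rmax_lub; lra. }
  assert (hx1 : Rabs A * Rabs dx <= Rabs dy + Rabs B * Rabs dt
                                    + e * Rmax (Rabs dx) (Rabs dt)).
  { rewrite <- !Rabs_mult.
    replace (A * dx) with (dy - B * dt - (dy - (A * dx + B * dt))) by ring.
    apply Rle_trans with (1 := Rabs_triang _ _); rewrite Rabs_Ropp.
    apply Rplus_le_compat; [|exact Hd1].
    apply Rle_trans with (1 := Rabs_triang _ _); rewrite Rabs_Ropp; lra. }
  assert (hx2 : Rabs A * Rabs dx <= Rabs A * (K * m)).
  { replace (Rabs A * (K * m)) with (2 * m + 2 * (Rabs B * m) + Rabs A * m)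
      by (unfold K; field; lra).
    pose proof (Rabs_pos dx); pose proof (Rabs_pos dt).
    assert (e * Rmax (Rabs dx) (Rabs dt) <= Rabs A / 2 * (Rabs dx + Rabs dt)).
    { apply Rmult_le_compat; try lra.
      apply Rle_trans with (2 := Rmax_l _ _); lra. }
    assert (Rabs B * Rabs dt <= Rabs B * m)
      by (apply Rmult_le_compat_l; [apply Rabs_pos | lra]).
    assert (Rabs A * Rabs dt <= Rabs A * m)
      by (apply Rmult_le_compat_l; lra).
    nra. }
  apply Rmult_le_reg_l in hx2; [|exact pA].
  assert (hM2 : Rmax (Rabs dx) (Rabs dt) <= K * m).
  { apply Rmax_lub; [exact hx2|].
    pose proof (Rabs_pos dt); nra. }
  apply Rmult_le_reg_l with (Rabs A); [exact pA|]; rewrite <- Rabs_mult.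
  replace (A * (dx - (/ A * dy + - B / A * dt)))
    with (- (dy - (A * dx + B * dt))) by (field; exact hA).
  rewrite Rabs_Ropp; apply Rle_trans with (1 := Hd1).
  apply Rle_trans with (e * (K * m)); [apply Rmult_le_compat_l; lra|].
  pose proof (Rle_trans _ _ _ (Rabs_pos dy) my); nra.
Qed.

(** (x, t) |-> (X x t, t + c) and (y, s) |-> (g y s, s - c) are mutually
    inverse bijections between D and D'. *)
Definition inverse_pair (c : R) (D : region) (X : field) (D' : region)
    (g : field) : Prop :=
  (forall x t, D (x, t) -> D' (X x t, t + c) /\ g (X x t) (t + c) = x) /\
  (forall y s, D' (y, s) -> D (g y s, s - c) /\ X (g y s) (s - c) = y).

Lemma inverse_pair_sym (c : R) (D D' : region) (X g : field) :
  inverse_pair c D X D' g -> inverse_pair (- c) D' g D X.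
Proof.
  intros [H1 H2]; split; intros a b Hab.
  - exact (H2 a b Hab).
  - replace (b - - c) with (b + c) by ring; exact (H1 a b Hab).
Qed.

Lemma inverse_pair_differentiable (c : R) (D D' : region) (X g a b : field) :
  open D -> inverse_pair c D X D' g ->
  (forall x t, D (x, t) -> a x t <> 0 /\
     differentiable_pt_lim X x t (a x t) (b x t)) ->
  forall y s, D' (y, s) ->
    differentiable_pt_lim g y s
      (/ a (g y s) (s - c)) (- b (g y s) (s - c) / a (g y s) (s - c)).
Proof.
  intros oD [Hf Hb] HX y s Dys; destruct (Hb y s Dys) as [Dg Eg].
  destruct (HX _ _ Dg) as [ha hX].
  pose proof (differentiable_pt_lim_inverse D X g c (g y s) (s - c)
                (a (g y s) (s - c)) (b (g y s) (s - c)) oD Dg) as H.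
  rewrite Eg in H; replace (s - c + c) with s in H by ring.
  apply H; auto.
  - intros x t Dx; exact (differentiable_pt_lim_continuity _ _ _ _ _ (proj2 (HX x t Dx))).
  - intros x t Dx; apply (Hf x t Dx).
Qed.

Lemma class_C_pull (k : nat) (D D' : region) (c : R) (f X : field) :
  open D -> class_C k D' f -> class_C k D X ->
  (forall x t, D (x, t) -> D' (X x t, t + c)) ->
  class_C k D (fun x t => f (X x t) (t + c)).
Proof.
  intros oD Hf HX HD.
  apply (class_C_comp k D D' f X (fun _ t => t + c)); auto.
  apply class_C_plus; auto using class_C_snd, class_C_const.
Qed.

(** The derivatives of g are a and b composed with g, so that g gains one
    derivative at a time until the regularity of a and b is exhausted. *)
Lemma class_C_inverse (k : nat) (c : R) (D D' : region) (X g a b : field) :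
  open D -> open D' -> inverse_pair c D X D' g ->
  class_C k D a -> class_C k D b ->
  (forall x t, D (x, t) -> a x t <> 0 /\
     differentiable_pt_lim X x t (a x t) (b x t)) ->
  class_C (S k) D' g.
Proof.
  intros oD oD' HI Ha Hb HX.
  pose proof (inverse_pair_differentiable c D D' X g a b oD HI HX) as Hg.
  assert (HD : forall y s, D' (y, s) -> D (g y s, s + - c)) by (apply HI).
  assert (step : forall j, (j <= k)%nat -> class_C j D' g -> class_C (S j) D' g).
  { intros j hj Hgj.
    assert (Hpull : forall f, class_C k D f ->
                    class_C j D' (fun y s => f (g y s) (s - c))).
    { intros f Hf; apply (class_C_pull j D' D (- c)); auto.
      now apply (class_C_le k). }
    assert (Hinv : class_C j D' (fun y s => / a (g y s) (s - c))).
    { apply (class_C_smooth j D' _ Rinv _ oD' smooth_inv); auto.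
      intros y s Dy; apply HX, (HD y s Dy). }
    apply (class_C_intro j D' g _ _ oD' Hg); auto.
    apply class_C_mult; auto.
    apply (class_C_ext j D' (fun y s => -1 * b (g y s) (s - c))); auto.
    - intros; ring.
    - apply class_C_mult; auto using class_C_const. }
  assert (all : forall j, (j <= k)%nat -> class_C (S j) D' g).
  { induction j as [|j IH]; intros hj; apply step; auto; [|apply IH; lia].
    intros y s Dy; exact (differentiable_pt_lim_continuity _ _ _ _ _ (Hg y s Dy)). }
  now apply all.
Qed.

(** A region on which X_x does not vanish need not be mapped injectively by
    (x, t) |-> (X(x, t), t + c), but a box is, by Rolle's theorem. *)
Lemma local_inverse (D : region) (X a b : field) (c x0 t0 : R) :
  open D -> D (x0, t0) ->
  (forall x t, D (x, t) -> a x t <> 0 /\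
     differentiable_pt_lim X x t (a x t) (b x t)) ->
  exists D0 D0' g, open D0 /\ subregion D0 D /\ D0 (x0, t0) /\ open D0' /\
    inverse_pair c D0 X D0' g.
Proof.
  intros oD Dx HX.
  destruct (box_in_open D x0 t0 oD Dx) as [d [hd Hbox]].
  set (D0 := box x0 t0 d).
  set (sol := fun y s x => D0 (x, s - c) /\ X x (s - c) = y).
  set (g := fun y s => epsilon (inhabits 0) (sol y s)).
  set (D0' := fun q : R * R => exists x, sol (fst q) (snd q) x).
  assert (Hg : forall y s, D0' (y, s) -> sol y s (g y s))
    by (intros y s H; exact (epsilon_spec _ _ H)).
  assert (inj : forall x1 x2 t, D0 (x1, t) -> D0 (x2, t) -> X x1 t = X x2 t ->
                x1 = x2).
  { intros x1 x2 t [h1 ht] [h2 _] E; simpl in h1, ht, h2.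
    assert (HB : forall x, Rmin x1 x2 <= x <= Rmax x1 x2 -> D (x, t)).
    { intros x hx; apply Hbox; split; simpl; auto.
      apply Rabs_def2 in h1; apply Rabs_def2 in h2.
      revert hx; apply Rmin_case; apply Rmax_case; intros; apply Rabs_def1; lra. }
    destruct (MVT_gen (fun x => X x t) x1 x2 (fun x => a x t)) as [x [hx Ex]].
    - intros x hx; apply (differentiable_pt_lim_is_derive1 _ _ _ _ (b x t)).
      apply HX, HB; lra.
    - intros x hx; apply continuity_pt_filterlim, continuous_section1.
      apply (differentiable_pt_lim_continuity _ _ _ (a x t) (b x t)), HX, HB, hx.
    - pose proof (proj1 (HX x t (HB x hx))).
      assert (E0 : a x t * (x2 - x1) = 0) by lra.
      apply Rmult_integral in E0; lra. }
  exists D0, D0', g; split; [apply box_open|].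
  split; [exact Hbox|]; split; [now apply box_center|].
  assert (oD0 : open D0) by apply box_open.
  split; [|split].
  - apply open_of_locally_2d; intros y s [x [Dxs Ex]]; simpl in Dxs, Ex.
    destruct (HX x (s - c) (Hbox _ Dxs)) as [ha hX].
    destruct (solve_nearby D0 X x (s - c) (a x (s - c)) (b x (s - c)) 1 oD0 Dxs)
      as [e [he He]]; [|exact hX|exact ha|lra|].
    { intros x' t' H'; apply (differentiable_pt_lim_continuity _ _ _ (a x' t') (b x' t')).
      apply HX, Hbox, H'. }
    exists (mkposreal e he); simpl; intros y' s' hy hs.
    rewrite <- Ex in hy; destruct (He y' (s' - c) hy) as [x' [_ H']].
    { now replace (s' - c - (s - c)) with (s' - s) by ring. }
    now exists x'.
  - intros x t Dxt.
    assert (H : sol (X x t) (t + c) x)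
      by (split; replace (t + c - c) with t by ring; auto).
    assert (H' : D0' (X x t, t + c)) by (now exists x).
    split; [exact H'|]; destruct (Hg _ _ H') as [Dg E1].
    replace (t + c - c) with t in Dg, E1 by ring.
    now apply (inj _ _ t).
  - exact Hg.
Qed.

(** * Closed and exact differential forms *)

(** Schwarz's theorem. *)
Lemma mixed_derivatives (D : region) (f : field) :
  open D -> class_C 2 D f ->
  forall x t, D (x, t) -> D2 (D1 f) x t = D1 (D2 f) x t.
Proof.
  intros oD [Hd [[H1d [H11 H12]] [H2d [H21 H22]]]] x t Dx.
  symmetry; apply (Schwarz f x t).
  - destruct (open_locally_2d D x t oD Dx) as [d hd].
    exists d; intros u v hu hv; specialize (hd u v hu hv).
    split; [|split; [|split]].
    + eexists; exact (differentiable_pt_lim_is_derive1 _ _ _ _ _ (Hd u v hd)).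
    + eexists; exact (differentiable_pt_lim_is_derive2 _ _ _ _ _ (Hd u v hd)).
    + eexists; exact (differentiable_pt_lim_is_derive1 _ _ _ _ _ (H2d u v hd)).
    + eexists; exact (differentiable_pt_lim_is_derive2 _ _ _ _ _ (H1d u v hd)).
  - exact (H21 x t Dx).
  - exact (H12 x t Dx).
Qed.

Lemma closed_of_potential (D : region) (f a b : field) :
  open D ->
  (forall x t, D (x, t) -> differentiable_pt_lim f x t (a x t) (b x t)) ->
  class_C 1 D a -> class_C 1 D b ->
  forall x t, D (x, t) -> D2 a x t = D1 b x t.
Proof.
  intros oD Hf Ha Hb x t Dx.
  pose proof (class_C_intro 1 D f a b oD Hf Ha Hb) as H2.
  rewrite <- (D2_ext_open D (D1 f) a oD), <- (D1_ext_open D (D2 f) b oD); auto.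
  - now apply (mixed_derivatives D).
  - intros y s Dy; apply (differentiable_pt_lim_D _ _ _ _ _ (Hf y s Dy)).
  - intros y s Dy; apply (differentiable_pt_lim_D _ _ _ _ _ (Hf y s Dy)).
Qed.

Lemma box_between (D : region) (x0 t0 d x y t : R) :
  subregion (box x0 t0 d) D -> Rabs (x - x0) < d -> Rabs (t - t0) < d ->
  Rmin x0 x <= y <= Rmax x0 x -> D (y, t).
Proof.
  intros H hx ht hy; apply H; split; simpl; auto.
  apply Rabs_def2 in hx.
  revert hy; apply Rmin_case; apply Rmax_case; intros; apply Rabs_def1; lra.
Qed.

(** The potential is the integral of the form along the path that runs from
    (x0, t0) first in the direction of t, then in that of x. *)
Lemma local_potential (D : region) (a b : field) (x0 t0 : R) :
  open D -> D (x0, t0) -> class_C 1 D a -> class_C 1 D b ->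
  (forall x t, D (x, t) -> D2 a x t = D1 b x t) ->
  exists d f, 0 < d /\ subregion (box x0 t0 d) D /\ f x0 t0 = 0 /\
    forall x t, box x0 t0 d (x, t) ->
      differentiable_pt_lim f x t (a x t) (b x t).
Proof.
  intros oD Dx [Had [Ha1 Ha2]] [Hbd [Hb1 Hb2]] Hcl.
  destruct (box_in_open D x0 t0 oD Dx) as [d [hd Hbox]].
  assert (cont : forall f, (forall x t, D (x, t) ->
      differentiable_pt_lim f x t (D1 f x t) (D2 f x t)) ->
      forall x t, D (x, t) -> continuity_2d_pt f x t).
  { intros f Hf x t H; exact (differentiable_pt_lim_continuity _ _ _ _ _ (Hf x t H)). }
  pose proof (cont a Had) as Ha0; pose proof (cont b Hbd) as Hb0.
  assert (mem : forall x t y, box x0 t0 d (x, t) -> Rmin x0 x <= y <= Rmax x0 x ->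
                D (y, t)).
  { intros x t y [hx ht]; apply (box_between D x0 t0 d x y t Hbox hx ht). }
  assert (mem2 : forall t s, Rabs (t - t0) < d -> Rmin t0 t <= s <= Rmax t0 t ->
                 D (x0, s)).
  { intros t s ht hs; apply Hbox; split; simpl.
    - rewrite Rminus_diag, Rabs_R0; exact hd.
    - apply Rabs_def2 in ht.
      revert hs; apply Rmin_case; apply Rmax_case; intros; apply Rabs_def1; lra. }
  assert (ia : forall x t, box x0 t0 d (x, t) -> ex_RInt (fun y => a y t) x0 x).
  { intros x t Bx; apply (@ex_RInt_continuous R_CompleteNormedModule).
    intros y hy; apply continuous_section1, Ha0, (mem x t y Bx hy). }
  assert (ib : forall t, Rabs (t - t0) < d -> ex_RInt (fun s => b x0 s) t0 t).
  { intros t ht; apply (@ex_RInt_continuous R_CompleteNormedModule).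
    intros s hs; apply continuous_section2, Hb0, (mem2 t s ht hs). }
  exists d, (fun x t => RInt (fun s => b x0 s) t0 t + RInt (fun y => a y t) x0 x).
  split; [exact hd|]; split; [exact Hbox|]; split.
  { rewrite !RInt_point; unfold zero; simpl; ring. }
  assert (near : forall x t, box x0 t0 d (x, t) ->
                 locally_2d (fun y s => box x0 t0 d (y, s)) x t)
    by (intros x t; apply open_locally_2d, box_open).
  intros x t Bx; apply (differentiable_pt_lim_of_partials _ a); [| |now apply Ha0, Hbox].
  - destruct (near x t Bx) as [e he]; exists e; intros y s hy hs.
    specialize (he y s hy hs).
    replace (a y s) with (0 + a y s) by ring.
    apply (is_derive_plus (fun _ => RInt (fun s' => b x0 s') t0 s)
             (fun z => RInt (fun y' => a y' s) x0 z)).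
    + apply is_derive_Reals, derivable_pt_lim_const.
    + apply (is_derive_RInt (fun y' => a y' s) _ x0).
      * apply filter_imp with (2 := locally_2d_1d_const_y _ _ _ (near y s he)).
        intros z hz; apply (@RInt_correct R_CompleteNormedModule), ia, hz.
      * apply continuous_section1, Ha0, Hbox, he.
  - replace (b x t) with (b x0 t + RInt (fun y => D1 b y t) x0 x).
    + apply (is_derive_plus (fun s => RInt (fun s' => b x0 s') t0 s)
               (fun s => RInt (fun y => a y s) x0 x)).
      * apply (is_derive_RInt (fun s' => b x0 s') _ t0).
        -- apply filter_imp with (2 := locally_2d_1d_const_x _ _ _ (near x t Bx)).
           intros s hs; apply (@RInt_correct R_CompleteNormedModule), ib, hs.
        -- apply continuous_section2, Hb0, (mem x t x0 Bx).
           split; [apply Rmin_l | apply Rmax_l].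
      * rewrite (RInt_ext _ (fun y => D2 a y t)).
        -- apply (is_derive_RInt_param (fun s y => a y s) x0 x t).
           ++ apply filter_imp with (2 := locally_2d_1d_const_x _ _ _ (near x t Bx)).
              intros s hs y hy; eexists.
              exact (differentiable_pt_lim_is_derive2 _ _ _ _ _ (Had y s (mem x s y hs hy))).
           ++ intros y hy eps; destruct (Ha2 y t (mem x t y Bx hy) eps) as [e he].
              exists e; intros; now apply he.
           ++ apply filter_imp with (2 := locally_2d_1d_const_x _ _ _ (near x t Bx)).
              intros s hs; apply ia, hs.
        -- intros y hy; symmetry; apply Hcl, (mem x t y Bx); lra.
    + rewrite (RInt_Derive (fun y => b y t)).
      * ring.
      * intros y hy; eexists.
        exact (differentiable_pt_lim_is_derive1 _ _ _ _ _ (Hbd y t (mem x t y Bx hy))).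
      * intros y hy; apply continuous_section1 with (f := D1 b), Hb1, (mem x t y Bx hy).
Qed.

(** dT = dt leaves only a translation of time, which may depend on the
    connected component. *)
Lemma time_translation (D : region) (T : field) (x0 t0 : R) :
  open D -> D (x0, t0) ->
  (forall x t, D (x, t) -> differentiable_pt_lim T x t 0 1) ->
  exists d, 0 < d /\ subregion (box x0 t0 d) D /\
    forall x t, box x0 t0 d (x, t) -> T x t = t + (T x0 t0 - t0).
Proof.
  intros oD Dx HT; destruct (box_in_open D x0 t0 oD Dx) as [d [hd Hbox]].
  exists d; split; [exact hd|]; split; [exact Hbox|]; intros x t [hx ht].
  simpl in hx, ht.
  assert (h0 : Rabs (x0 - x0) < d) by (now rewrite Rminus_diag, Rabs_R0).
  destruct (MVT_cor4 (fun y => T y t) (fun _ => 0) x0 (Rabs (x - x0))) with (b := x)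
    as [y [Ey _]]; [|lra|].
  { intros y hy; apply (differentiable_pt_lim_is_derive1 T y t 0 1), HT, Hbox.
    split; simpl; lra. }
  destruct (MVT_cor4 (fun s => T x0 s) (fun _ => 1) t0 (Rabs (t - t0))) with (b := t)
    as [s [Es _]]; [|lra|].
  { intros s hs; apply (differentiable_pt_lim_is_derive2 T x0 s 0 1), HT, Hbox.
    split; simpl; lra. }
  lra.
Qed.

(** * A pair of diffusion equations related by a hodograph transformation *)

(** The equations
      u_t = (mobility(u) u_x)_x + law_mu / x mobility(u) u_x,
      u'_t' = (mobility'(u') u'_x')_x'
    and the transformation x' = v, t' = t, u' = weight(x) / u,
    v' = height(x) between their potential systems; in the first system
    v_t = x mobility(u) u_x + drift(u). *)
Record law := Law {
  x_dom : R -> Prop;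
  u_dom : R -> Prop;
  u'_dom : R -> Prop;
  v'_dom : R -> Prop;
  mobility : R -> R;
  drift : R -> R;
  mobility' : R -> R;
  weight : R -> R;
  height : R -> R;
  height_inv : R -> R;
  law_mu : R }.

Definition law_flux (L : law) (u : field) : field := fun x t =>
  x * mobility L (u x t) * D1 u x t + drift L (u x t).

Definition law_flux' (L : law) (u' : field) : field := fun y s =>
  mobility' L (u' y s) * D1 u' y s.

Definition law_radial (L : law) (D : region) (u : field) : Prop :=
  C2_on D u /\
  forall x t, D (x, t) ->
    x_dom L x /\ u_dom L (u x t) /\
    D2 u x t = D1 (fun y s => mobility L (u y s) * D1 u y s) x t
               + law_mu L / x * (mobility L (u x t) * D1 u x t).

Definition law_diffusion (L : law) (D' : region) (u' : field) : Prop :=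
  C2_on D' u' /\
  forall x t, D' (x, t) ->
    u'_dom L (u' x t) /\
    D2 u' x t = D1 (fun y s => mobility' L (u' y s) * D1 u' y s) x t.

Definition law_radial_potential (L : law) (D : region) (w : field * field)
    : Prop :=
  let (u, v) := w in
  C2_on D u /\ C2_on D v /\
  forall x t, D (x, t) ->
    x_dom L x /\ u_dom L (u x t) /\
    D1 v x t = u x t * x /\
    D2 v x t = law_flux L u x t.

Definition law_diffusion_potential (L : law) (D' : region) (w' : field * field)
    : Prop :=
  let (u', v') := w' in
  C2_on D' u' /\ C2_on D' v' /\
  forall x t, D' (x, t) ->
    u'_dom L (u' x t) /\ v'_dom L (v' x t) /\
    D1 v' x t = u' x t /\
    D2 v' x t = mobility' L (u' x t) * D1 u' x t.

Definition law_point_image (L : law) (D : region) (w : field * field)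
    (D' : region) (w' : field * field) : Prop :=
  (forall x t, D (x, t) -> x_dom L x /\ u_dom L (fst w x t)) /\
  forall q', graph D' w' q' <->
    exists q, graph D w q /\
      q' = let '(x, t, u, v) := q in (v, t, weight L x * / u, height L x).

Definition law_contact (L : law) (b X T : field) (D : region) (u : field)
    (D' : region) (u' : field) : Prop :=
  (forall x t, D (x, t) -> x_dom L x /\ u_dom L (u x t)) /\
  differential_image
    (fun x t => u x t * x) b (fun x t => weight L x * / u x t) X T D D' u'.

(** The identities that make the transformation work are [drift_derive], which
    makes the closedness of u x dx + v_t dt equivalent to the equation for u;
    [height_derive], which makes the height a potential of u'; and
    [weight_derive] and [mobility_image], which identify the fluxes. *)
Record hodograph_law (L : law) : Prop := HodographLaw {
  x_open : open (x_dom L);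
  u_open : open (u_dom L);
  u'_open : open (u'_dom L);
  v'_open : open (v'_dom L);
  x_neq0 : forall x, x_dom L x -> x <> 0;
  u_neq0 : forall u, u_dom L u -> u <> 0;
  u'_neq0 : forall u, u'_dom L u -> u <> 0;
  weight_neq0 : forall x, x_dom L x -> weight L x <> 0;
  x_one : x_dom L 1;
  mobility_smooth : smooth (u_dom L) (mobility L);
  drift_smooth : smooth (u_dom L) (drift L);
  mobility'_smooth : smooth (u'_dom L) (mobility' L);
  weight_smooth : smooth (x_dom L) (weight L);
  height_smooth : smooth (x_dom L) (height L);
  height_inv_smooth : smooth (v'_dom L) (height_inv L);
  drift_derive : forall u, u_dom L u ->
    is_derive (drift L) u ((law_mu L - 1) * mobility L u);
  weight_derive : forall x u, x_dom L x -> u_dom L u ->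
    x * u * mobility L u * Derive (weight L) x = - (drift L u * weight L x);
  height_derive : forall x, x_dom L x ->
    is_derive (height L) x (x * weight L x);
  image_dom : forall x u, x_dom L x -> u_dom L u ->
    u'_dom L (weight L x * / u);
  preimage_dom : forall x u', x_dom L x -> u'_dom L u' ->
    u_dom L (weight L x * / u');
  mobility_image : forall x u, x_dom L x -> u_dom L u ->
    mobility' L (weight L x * / u) = x * x * (u * u) * mobility L u;
  height_dom : forall x, x_dom L x -> v'_dom L (height L x);
  heightK : forall x, x_dom L x -> height_inv L (height L x) = x;
  height_inv_dom : forall y, v'_dom L y -> x_dom L (height_inv L y);
  height_invK : forall y, v'_dom L y -> height L (height_inv L y) = y }.

Lemma height_inv_derive (L : law) (ok : hodograph_law L) (y : R) :
  v'_dom L y ->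
  is_derive (height_inv L) y
    (/ (height_inv L y * weight L (height_inv L y))).
Proof.
  intros hy.
  destruct (smooth_ex_derive _ _ _ (height_inv_smooth L ok) hy) as [l hl].
  pose proof (height_inv_dom L ok y hy) as hx.
  pose proof (x_neq0 L ok _ hx); pose proof (weight_neq0 L ok _ hx).
  pose proof (is_derive_comp _ _ _ _ _ (height_derive L ok _ hx) hl) as H1.
  assert (H2 : is_derive (fun z => height L (height_inv L z)) y 1).
  { apply is_derive_ext_loc with (fun z => z); [|apply @is_derive_id].
    apply filter_imp with (2 := v'_open L ok y hy).
    intros z hz; symmetry; now apply height_invK. }
  apply is_derive_unique in H1; apply is_derive_unique in H2.
  rewrite H1 in H2; unfold scal in H2; simpl in H2; unfold mult in H2; simpl in H2.
  replace (/ (height_inv L y * weight L (height_inv L y))) with l; [exact hl|].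
  apply Rmult_eq_reg_r with (height_inv L y * weight L (height_inv L y)).
  - rewrite H2; field; auto.
  - apply Rmult_integral_contrapositive; auto.
Qed.

Lemma class_C_law_flux (L : law) (ok : hodograph_law L) (k : nat) (D : region)
    (u : field) :
  open D -> (forall x t, D (x, t) -> u_dom L (u x t)) ->
  class_C k D u -> class_C k D (D1 u) -> class_C k D (law_flux L u).
Proof.
  intros oD Hu Cu Cu1; apply class_C_plus; auto.
  - apply class_C_mult; auto; apply class_C_mult; auto using class_C_fst.
    apply (class_C_smooth k D (u_dom L)); auto; apply ok.
  - apply (class_C_smooth k D (u_dom L)); auto; apply ok.
Qed.

Lemma class_C_law_flux' (L : law) (ok : hodograph_law L) (k : nat) (D : region)
    (u' : field) :
  open D -> (forall x t, D (x, t) -> u'_dom L (u' x t)) ->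
  class_C (S k) D u' -> class_C k D (law_flux' L u').
Proof.
  intros oD Hu Cu; apply class_C_mult; auto; [|apply Cu].
  apply (class_C_smooth k D (u'_dom L)); auto; [apply ok | now apply class_C_pred].
Qed.

Lemma class_C_weight_div (L : law) (ok : hodograph_law L) (k : nat)
    (D : region) (g u : field) :
  open D -> (forall x t, D (x, t) -> x_dom L (g x t) /\ u x t <> 0) ->
  class_C k D g -> class_C k D u ->
  class_C k D (fun x t => weight L (g x t) * / u x t).
Proof.
  intros oD H Cg Cu; apply class_C_mult; auto.
  - apply (class_C_smooth k D (x_dom L)); auto; [apply ok | intros; now apply H].
  - apply (class_C_smooth k D _ Rinv u oD smooth_inv); auto; intros; now apply H.
Qed.

(** The form u x dx + b dt, with b the flux, is closed if and only if u
    satisfies the radial equation. *)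
Lemma radial_closed (L : law) (ok : hodograph_law L) (D : region) (u : field) :
  open D -> (forall x t, D (x, t) -> x_dom L x /\ u_dom L (u x t)) ->
  class_C 2 D u -> forall x t, D (x, t) ->
  (D2 (fun y s => u y s * y) x t = D1 (law_flux L u) x t <->
   D2 u x t = D1 (fun y s => mobility L (u y s) * D1 u y s) x t
              + law_mu L / x * (mobility L (u x t) * D1 u x t)).
Proof.
  intros oD Hd Cu x t Dx; destruct (Hd x t Dx) as [hx hu].
  pose proof (x_neq0 L ok x hx) as x0.
  destruct Cu as [du [Cu1 Cu2]].
  assert (CK : class_C 1 D (fun y s => mobility L (u y s) * D1 u y s)).
  { apply class_C_mult; auto; apply (class_C_smooth 1 D (u_dom L)); auto.
    - apply ok.
    - apply class_C_pred; split; auto.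
    - intros; now apply Hd. }
  assert (E2 : D2 (fun y s => u y s * y) x t = D2 u x t * x).
  { apply is_derive_unique.
    replace (D2 u x t * x) with (D2 u x t * x + u x t * 0) by ring.
    apply (is_derive_mult (fun s => u x s) (fun _ => x)).
    - exact (differentiable_pt_lim_is_derive2 _ _ _ _ _ (du x t Dx)).
    - apply is_derive_Reals, derivable_pt_lim_const.
    - intros; apply Rmult_comm. }
  assert (E1 : D1 (law_flux L u) x t =
               mobility L (u x t) * D1 u x t
               + x * D1 (fun y s => mobility L (u y s) * D1 u y s) x t
               + (law_mu L - 1) * mobility L (u x t) * D1 u x t).
  { pose proof (differentiable_pt_lim_smooth (drift L) u x t _ _ _
                  (drift_derive L ok _ hu) (du x t Dx)) as H1.
    pose proof (differentiable_pt_lim_mult (fun y _ => y) _ x t 1 0 _ _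
                  (differentiable_pt_lim_proj1_0 (fun y => y) x t 1
                     (derivable_pt_lim_id x)) (proj1 CK x t Dx)) as H2.
    pose proof (differentiable_pt_lim_plus _ _ _ _ _ _ _ _ H2 H1) as H3.
    apply differentiable_pt_lim_D in H3; destruct H3 as [H3 _].
    replace (D1 (law_flux L u) x t) with
      (D1 (fun y s => y * (mobility L (u y s) * D1 u y s) + drift L (u y s)) x t).
    - rewrite H3; ring.
    - apply (D1_ext_open D); auto; intros; unfold law_flux; ring. }
  rewrite E1, E2; split; intros E.
  - apply Rmult_eq_reg_r with x; auto; rewrite E; field; auto.
  - rewrite E; field; auto.
Qed.

(** Differentiating u' u = weight(x) along x' = X(x, t), where X_x = u x,
    relates u'_x' to u_x; the identities of the law turn this relation into
    one between the two fluxes. *)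
Lemma flux_relation (L : law) (ok : hodograph_law L) (D : region)
    (u u' X : field) (c x t b p q p' q' : R) :
  open D -> D (x, t) -> x_dom L x -> u_dom L (u x t) ->
  (forall y s, D (y, s) -> u' (X y s) (s + c) * u y s = weight L y) ->
  differentiable_pt_lim X x t (u x t * x) b ->
  differentiable_pt_lim u x t p q ->
  differentiable_pt_lim u' (X x t) (t + c) p' q' ->
  mobility' L (u' (X x t) (t + c)) * p' =
  - (u' (X x t) (t + c) * (x * mobility L (u x t) * p + drift L (u x t))).
Proof.
  intros oD Dx hx hu E HX Hu Hu'.
  pose proof (x_neq0 L ok x hx) as x0; pose proof (u_neq0 L ok _ hu) as u0.
  pose proof (weight_neq0 L ok x hx) as w0.
  assert (HT : differentiable_pt_lim (fun _ s => s + c) x t 0 1).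
  { replace 0 with (0 + 0) by ring; replace 1 with (1 + 0) by ring.
    apply (differentiable_pt_lim_plus (fun _ s => s) (fun _ _ => c)).
    - apply differentiable_pt_lim_snd.
    - apply (differentiable_pt_lim_proj1_0 (fun _ => c)), derivable_pt_lim_const. }
  pose proof (differentiable_pt_lim_comp u' X (fun _ s => s + c) x t _ _ _ _ _ _
                Hu' HX HT) as H1.
  pose proof (differentiable_pt_lim_mult _ u x t _ _ _ _ H1 Hu) as H2.
  apply (differentiable_pt_lim_ext_open D _ (fun y _ => weight L y)) in H2; auto.
  apply differentiable_pt_lim_is_derive1, is_derive_unique in H2.
  assert (E' : u' (X x t) (t + c) = weight L x * / u x t).
  { rewrite <- (E x t Dx); field; auto. }
  pose proof (weight_derive L ok x (u x t) hx hu) as Hw.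
  rewrite E' in H2 |- *; rewrite (mobility_image L ok x _ hx hu).
  set (U := u x t) in *; set (K := mobility L U) in *; set (G := drift L U) in *.
  set (w := weight L x) in *.
  change (Derive (weight L) x = (p' * (U * x) + q' * 0) * U + w * / U * p) in H2.
  rewrite H2 in Hw.
  replace (- (w * / U * (x * K * p + G)))
    with (- (w * / U * (x * K * p)) - (G * w) * / U) by ring.
  replace (G * w)
    with (- (x * U * K * ((p' * (U * x) + q' * 0) * U + w * / U * p)))
    by (rewrite Hw; ring).
  field; auto.
Qed.

(** Once x' = X(x, t) is solved for x = g(x', t'), the height of g is a
    potential of u': its time derivative is - u' times the flux of u, which
    [flux_relation] identifies with the flux of u'. *)
Lemma hodograph_forward (L : law) (ok : hodograph_law L) (D D' : region)
    (u u' X g : field) (c : R) :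
  open D -> open D' -> inverse_pair c D X D' g ->
  (forall x t, D (x, t) -> x_dom L x /\ u_dom L (u x t)) ->
  (forall x t, D (x, t) -> u' (X x t) (t + c) = weight L x * / u x t) ->
  (forall x t, D (x, t) ->
     differentiable_pt_lim X x t (u x t * x) (law_flux L u x t)) ->
  class_C 2 D u ->
  class_C 2 D' g /\ class_C 2 D' u' /\
  (forall y s, D' (y, s) ->
     differentiable_pt_lim (fun z r => height L (g z r)) y s
       (u' y s) (law_flux' L u' y s)).
Proof.
  intros oD oD' HI Hd Hu' HX Cu.
  assert (Ca : class_C 1 D (fun x t => u x t * x))
    by (apply class_C_mult; auto using class_C_fst; now apply class_C_pred).
  assert (Cb : class_C 1 D (law_flux L u)).
  { apply class_C_law_flux; auto; [intros; now apply Hd | now apply class_C_pred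
                                  | apply Cu]. }
  assert (HX' : forall x t, D (x, t) -> u x t * x <> 0 /\
            differentiable_pt_lim X x t (u x t * x) (law_flux L u x t)).
  { intros x t Dx; split; auto; destruct (Hd x t Dx) as [hx hu].
    apply Rmult_integral_contrapositive; split;
      [now apply (u_neq0 L ok) | now apply (x_neq0 L ok)]. }
  pose proof (class_C_inverse 1 c D D' X g _ _ oD oD' HI Ca Cb HX') as Cg.
  pose proof (inverse_pair_differentiable c D D' X g _ _ oD HI HX') as Hg.
  destruct HI as [HI1 HI2].
  assert (Cu' : class_C 2 D' u').
  { apply (class_C_ext 2 D' (fun y s => weight L (g y s) * / u (g y s) (s - c))); auto.
    - intros y s Dy; destruct (HI2 y s Dy) as [Dg Eg].
      rewrite <- (Hu' _ _ Dg), Eg; f_equal; ring.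
    - apply (class_C_weight_div L ok 2 D' g (fun y s => u (g y s) (s - c))); auto.
      + intros y s Dy; destruct (Hd _ _ (proj1 (HI2 y s Dy))); split; auto.
        now apply (u_neq0 L ok).
      + apply (class_C_pull 2 D' D (- c)); auto; intros y s Dy; apply (HI2 y s Dy). }
  split; [exact Cg|]; split; [exact Cu'|].
  intros y s Dy; destruct (HI2 y s Dy) as [Dg Eg].
  destruct (Hd _ _ Dg) as [hx hu].
  pose proof (x_neq0 L ok _ hx) as x0; pose proof (u_neq0 L ok _ hu) as u0.
  pose proof (differentiable_pt_lim_smooth (height L) g y s _ _ _
                (height_derive L ok _ hx) (Hg y s Dy)) as H.
  assert (E' : u' y s = weight L (g y s) * / u (g y s) (s - c)).
  { rewrite <- (Hu' _ _ Dg), Eg; f_equal; ring. }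
  assert (F : law_flux' L u' y s = - (u' y s * law_flux L u (g y s) (s - c))).
  { assert (Hd' : differentiable_pt_lim u' (X (g y s) (s - c)) (s - c + c)
                    (D1 u' y s) (D2 u' y s)).
    { rewrite Eg; replace (s - c + c) with s by ring; apply Cu', Dy. }
    pose proof (flux_relation L ok D u u' X c (g y s) (s - c)
                  (law_flux L u (g y s) (s - c)) (D1 u (g y s) (s - c))
                  (D2 u (g y s) (s - c)) (D1 u' y s) (D2 u' y s) oD Dg hx hu) as R.
    assert (E0 : forall z r, D (z, r) -> u' (X z r) (r + c) * u z r = weight L z).
    { intros z r Dz; rewrite (Hu' z r Dz); field; apply (u_neq0 L ok), Hd, Dz. }
    specialize (R E0 (HX _ _ Dg) (proj1 Cu _ _ Dg) Hd').
    rewrite Eg in R; replace (s - c + c) with s in R by ring.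
    exact R. }
  rewrite F, E'.
  replace (weight L (g y s) * / u (g y s) (s - c)) with
    (g y s * weight L (g y s) * / (u (g y s) (s - c) * g y s)) by (field; auto).
  replace (- (g y s * weight L (g y s) * / (u (g y s) (s - c) * g y s)
              * law_flux L u (g y s) (s - c)))
    with (g y s * weight L (g y s)
          * (- law_flux L u (g y s) (s - c) / (u (g y s) (s - c) * g y s)))
    by (field; auto).
  exact H.
Qed.

(** No regularity of u is presupposed: u = weight(x) / u'(X, t + c) is as
    regular as X, hence differentiable; then u_x, and with it the flux X_t, is
    as regular as X, so that X gains one derivative.  Two rounds reach class
    C^2. *)
Lemma hodograph_bootstrap (L : law) (ok : hodograph_law L) (D D' : region)
    (u u' X b : field) (c : R) :
  open D ->
  (forall x t, D (x, t) -> x_dom L x /\ u_dom L (u x t)) ->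
  (forall x t, D (x, t) -> D' (X x t, t + c) /\
     u' (X x t) (t + c) = weight L x * / u x t) ->
  (forall x t, D (x, t) -> differentiable_pt_lim X x t (u x t * x) (b x t)) ->
  (forall x t, D (x, t) -> ex_derive (fun y => u y t) x ->
     b x t = law_flux L u x t) ->
  class_C 2 D' u' -> class_C 2 D u.
Proof.
  intros oD Hd Hu' HX Hb Cu'.
  assert (nz : forall x t, D (x, t) -> u' (X x t) (t + c) <> 0).
  { intros x t Dx; destruct (Hd x t Dx) as [hx hu]; rewrite (proj2 (Hu' x t Dx)).
    now apply (u'_neq0 L ok), (image_dom L ok). }
  assert (Eu : forall x t, D (x, t) -> weight L x * / u' (X x t) (t + c) = u x t).
  { intros x t Dx; destruct (Hd x t Dx) as [hx hu]; rewrite (proj2 (Hu' x t Dx)).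
    pose proof (weight_neq0 L ok _ hx); pose proof (u_neq0 L ok _ hu).
    field; auto. }
  assert (pull : forall j f, class_C j D' f -> class_C j D X ->
                 class_C j D (fun x t => f (X x t) (t + c))).
  { intros j f Hf CX; apply (class_C_pull j D D'); auto; intros; now apply Hu'. }
  assert (Cinv : forall j, (j <= 2)%nat -> class_C j D X ->
                 class_C j D (fun x t => / u' (X x t) (t + c))).
  { intros j hj CX; apply (class_C_smooth j D _ Rinv _ oD smooth_inv); auto.
    apply pull; auto; now apply (class_C_le 2). }
  assert (bump : forall j, (j <= 2)%nat -> class_C j D X -> class_C j D u).
  { intros j hj CX.
    apply (class_C_ext j D _ _ oD Eu), class_C_mult; auto.
    apply (class_C_smooth j D (x_dom L)); auto using class_C_fst; [apply ok|].
    intros; now apply (Hd x t). }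
  set (du := fun x t => Derive (weight L) x * / u' (X x t) (t + c)
     + weight L x * (-1 * (/ u' (X x t) (t + c) * / u' (X x t) (t + c))
                     * (D1 u' (X x t) (t + c) * (u x t * x)))).
  assert (Hdu : forall x t, D (x, t) -> is_derive (fun y => u y t) x (du x t)).
  { intros x t Dx; destruct (Hd x t Dx) as [hx hu].
    assert (H1 : is_derive (fun y => X y t) x (u x t * x))
      by exact (differentiable_pt_lim_is_derive1 _ _ _ _ _ (HX x t Dx)).
    assert (H2 : is_derive (fun y => u' y (t + c)) (X x t) (D1 u' (X x t) (t + c)))
      by exact (differentiable_pt_lim_is_derive1 _ _ _ _ _
                  (proj1 Cu' _ _ (proj1 (Hu' x t Dx)))).
    pose proof (is_derive_comp _ _ _ _ _ H2 H1) as H3.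
    pose proof (Derive_correct _ _ (smooth_ex_derive _ _ _ (weight_smooth L ok) hx))
      as H4.
    assert (H5 : is_derive (fun y => weight L y * / u' (X y t) (t + c)) x (du x t)).
    { pose proof (is_derive_inv _ _ _ H3 (nz x t Dx)) as H6.
      pose proof (is_derive_mult _ _ _ _ _ H4 H6 Rmult_comm) as H7.
      replace (du x t) with
        (plus (mult (Derive (weight L) x) (/ u' (X x t) (t + c)))
           (mult (weight L x)
              (- scal (u x t * x) (D1 u' (X x t) (t + c))
               / u' (X x t) (t + c) ^ 2))); [exact H7|].
      unfold du, plus, mult, scal; simpl; unfold mult; simpl.
      field; now apply nz. }
    apply is_derive_ext_loc with (2 := H5).
    destruct (open_locally_2d D x t oD Dx) as [d hdl].
    exists d; intros y hy; apply Eu, hdl; [exact hy|].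
    rewrite Rminus_diag, Rabs_R0; apply cond_pos. }
  assert (step : forall j, (j <= 1)%nat -> class_C j D X -> class_C (S j) D X).
  { intros j hj CX.
    assert (Cu : class_C j D u) by (apply bump; [lia | exact CX]).
    assert (Cx : class_C j D (fun x t => u x t * x))
      by (apply class_C_mult; auto using class_C_fst).
    assert (Ci : class_C j D (fun x t => / u' (X x t) (t + c)))
      by (apply Cinv; [lia | exact CX]).
    assert (Cdu : class_C j D du).
    { apply class_C_plus; auto; apply class_C_mult; auto.
      - apply (class_C_ext j D (fun x _ => D1 (fun y _ => weight L y) x 0)); auto.
        apply (class_C_sub j (fun p => x_dom L (fst p)) D).
        + intros [x t] Dx; now apply (Hd x t).
        + apply (weight_smooth L ok (S j)).
      - apply (class_C_smooth j D (x_dom L)); auto using class_C_fst; [apply ok|].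
        intros; now apply (Hd x t).
      - apply class_C_mult; auto.
        + apply class_C_mult; auto using class_C_const, class_C_mult.
        + apply class_C_mult; auto; apply pull; auto.
          apply (class_C_le 1); [exact hj | apply Cu']. }
    apply (class_C_intro j D X _ _ oD HX Cx).
    apply (class_C_ext j D (law_flux L u)); auto.
    - intros x t Dx; symmetry; apply Hb; auto; exists (du x t); auto.
    - apply class_C_law_flux; auto; [intros; now apply Hd|].
      apply (class_C_ext j D du); auto.
      intros x t Dx; symmetry; apply is_derive_unique, Hdu, Dx. }
  apply bump; auto; apply step; auto; apply step; auto.
  intros x t Dx; exact (differentiable_pt_lim_continuity _ _ _ _ _ (HX x t Dx)).
Qed.

(** Once u and u' are known to be of class C^2, both equations hold
    automatically: X is a potential for the form of the radial equation, the
    height of the local inverse of X is one for the form of the diffusion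
    equation, and both forms are therefore closed.  The coefficient b is only
    required to be the flux where u is differentiable, because the values of
    [Derive] elsewhere carry no meaning. *)
Lemma law_contact_solutions (L : law) (ok : hodograph_law L) (b X T : field)
    (D D' : region) (u u' : field) :
  open D -> open D' -> law_contact L b X T D u D' u' ->
  (forall x t, D (x, t) -> ex_derive (fun y => u y t) x ->
     b x t = law_flux L u x t) ->
  (law_radial L D u <-> law_diffusion L D' u').
Proof.
  intros oD oD' [Hd [HXT Himg]] Hb.
  assert (Himg1 : forall x t, D (x, t) -> D' (X x t, T x t) /\
                  u' (X x t) (T x t) = weight L x * / u x t).
  { intros x t Dx; destruct (proj2 (Himg (X x t) (T x t) (weight L x * / u x t)))
      as [h1 h2]; [now exists x, t | auto]. }
  assert (Himg2 : forall y s, D' (y, s) -> exists x t, D (x, t) /\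
                  y = X x t /\ s = T x t).
  { intros y s Dy; destruct (proj1 (Himg y s (u' y s)) (conj Dy eq_refl))
      as [x [t [Dx [h1 [h2 _]]]]]; now exists x, t. }
  (* Near every point, T is a translation of t. *)
  assert (loc : forall x t, D (x, t) -> exists D0, open D0 /\ subregion D0 D /\
     D0 (x, t) /\ exists c, forall y s, D0 (y, s) -> T y s = s + c).
  { intros x t Dx.
    destruct (time_translation D T x t oD Dx) as [d [hd [hD hT]]];
      [intros; now apply HXT|].
    exists (box x t d); split; [apply box_open|]; split; [exact hD|].
    split; [now apply box_center|]; eexists; exact hT. }
  assert (reg : class_C 2 D' u' -> C2_on D u).
  { intros Cu' x t Dx; destruct (loc x t Dx) as [D0 [oD0 [h0 [Dx0 [c hT]]]]].
    apply (class_C_ex_diff_n 2 D0); [|exact Dx0].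
    apply (hodograph_bootstrap L ok D0 D' u u' X b c); auto.
    - intros y s Dy; destruct (Himg1 y s (h0 _ Dy)) as [h1 h2].
      rewrite (hT y s Dy) in h1, h2; auto.
    - intros y s Dy; apply HXT, h0, Dy. }
  assert (main : C2_on D u -> forall x t, D (x, t) ->
     exists D0', open D0' /\ subregion D0' D' /\ D0' (X x t, T x t) /\
       class_C 2 D0' u' /\
       D2 u x t = D1 (fun y s => mobility L (u y s) * D1 u y s) x t
                  + law_mu L / x * (mobility L (u x t) * D1 u x t) /\
       D2 u' (X x t) (T x t) = D1 (law_flux' L u') (X x t) (T x t)).
  { intros Cu x t Dx; destruct (loc x t Dx) as [D1' [oD1 [h1 [Dx1 [c hT]]]]].
    apply C2_on_class_C in Cu; auto.
    assert (HX : forall y s, D (y, s) ->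
       differentiable_pt_lim X y s (u y s * y) (law_flux L u y s)).
    { intros y s Dy; rewrite <- Hb; auto; [apply HXT, Dy|].
      eexists; exact (differentiable_pt_lim_is_derive1 _ _ _ _ _ (proj1 Cu y s Dy)). }
    destruct (local_inverse D1' X (fun y s => u y s * y) (law_flux L u) c x t)
      as [D0 [D0' [g [oD0 [h0 [Dx0 [oD0' HI]]]]]]]; auto.
    { intros y s Dy; split; auto.
      destruct (Hd y s (h1 _ Dy)) as [hy hu].
      apply Rmult_integral_contrapositive; split;
        [now apply (u_neq0 L ok) | now apply (x_neq0 L ok)]. }
    assert (sub : subregion D0 D) by (intros p Dp; auto).
    assert (sub' : subregion D0' D').
    { intros [y s] Dy; destruct (proj2 HI y s Dy) as [Dg Eg].
      destruct (Himg1 _ _ (sub _ Dg)) as [h _]; rewrite (hT _ _ (h0 _ Dg)), Eg in h.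
      now replace (s - c + c) with s in h by ring. }
    destruct (hodograph_forward L ok D0 D0' u u' X g c) as [_ [Cu' Hpot]]; auto.
    { intros y s Dy; rewrite <- (hT _ _ (h0 _ Dy)); apply Himg1, sub, Dy. }
    { now apply (class_C_sub 2 D). }
    assert (Dp : D0' (X x t, T x t))
      by (rewrite (hT x t Dx1); apply (proj1 HI x t Dx0)).
    assert (Hd' : forall y s, D0' (y, s) -> u'_dom L (u' y s)).
    { intros y s Dy; destruct (Himg2 y s (sub' _ Dy)) as [z [r [Dz [-> ->]]]].
      rewrite (proj2 (Himg1 z r Dz)).
      destruct (Hd z r Dz); now apply (image_dom L ok). }
    exists D0'; split; [exact oD0'|]; split; [exact sub'|]; split; [exact Dp|].
    split; [exact Cu'|]; split.
    - apply (radial_closed L ok D); auto.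
      apply (closed_of_potential D X); auto.
      + apply class_C_mult; auto using class_C_fst; now apply class_C_pred.
      + apply class_C_law_flux; auto; [intros; now apply Hd
          | now apply class_C_pred | apply Cu].
    - apply (closed_of_potential D0' _ u' (law_flux' L u') oD0' Hpot); auto.
      + now apply class_C_pred.
      + now apply class_C_law_flux'. }
  split.
  - intros [Cu _]; split.
    + intros y s Dy; destruct (Himg2 y s Dy) as [x [t [Dx [-> ->]]]].
      destruct (main Cu x t Dx) as [D0' [_ [_ [Dp [Cu' _]]]]].
      now apply (class_C_ex_diff_n 2 D0').
    + intros y s Dy; destruct (Himg2 y s Dy) as [x [t [Dx [-> ->]]]].
      destruct (main Cu x t Dx) as [D0' [_ [_ [_ [_ [_ E]]]]]]; split; [|exact E].
      rewrite (proj2 (Himg1 x t Dx)).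
      destruct (Hd x t Dx); now apply (image_dom L ok).
  - intros [Cu' _]; apply C2_on_class_C in Cu'; auto.
    pose proof (reg Cu') as Cu; split; [exact Cu|]; intros x t Dx.
    destruct (Hd x t Dx) as [hx hu]; split; [exact hx|]; split; [exact hu|].
    now destruct (main Cu x t Dx) as [D0' [_ [_ [_ [_ [E _]]]]]].
Qed.

(** * The point transformation of the potential systems *)

Lemma law_radial_potential_sub (L : law) (D D0 : region) (w : field * field) :
  subregion D0 D -> law_radial_potential L D w -> law_radial_potential L D0 w.
Proof.
  destruct w as [u v]; intros h [Cu [Cv H]].
  split; [|split]; intros x t Dx; [apply Cu | apply Cv | apply H]; auto.
Qed.

Lemma law_diffusion_potential_sub (L : law) (D D0 : region) (w : field * field) :
  subregion D0 D -> law_diffusion_potential L D w ->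
  law_diffusion_potential L D0 w.
Proof.
  destruct w as [u v]; intros h [Cu [Cv H]].
  split; [|split]; intros x t Dx; [apply Cu | apply Cv | apply H]; auto.
Qed.

Lemma law_radial_potential_differentiable (L : law) (D : region) (u v : field) :
  open D -> law_radial_potential L D (u, v) -> forall x t, D (x, t) ->
  differentiable_pt_lim v x t (u x t * x) (law_flux L u x t).
Proof.
  intros oD [_ [Cv H]] x t Dx; apply C2_on_class_C in Cv; auto.
  destruct (H x t Dx) as [_ [_ [<- <-]]]; apply Cv, Dx.
Qed.

(** Since x is recovered from v' by inverting the height, a point image makes
    (x, t) |-> (v, t) a bijection of D onto D', without any further
    assumption of injectivity. *)
Lemma law_point_image_unpack (L : law) (ok : hodograph_law L) (D D' : region)
    (u v u' v' : field) :
  law_point_image L D (u, v) D' (u', v') ->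
  (forall x t, D (x, t) -> x_dom L x /\ u_dom L (u x t)) /\
  inverse_pair 0 D v D' (fun y s => height_inv L (v' y s)) /\
  (forall x t, D (x, t) ->
     u' (v x t) (t + 0) = weight L x * / u x t /\ v' (v x t) (t + 0) = height L x).
Proof.
  intros [Hd Himg]; simpl in Hd.
  assert (H1 : forall x t, D (x, t) -> D' (v x t, t) /\
     u' (v x t) t = weight L x * / u x t /\ v' (v x t) t = height L x).
  { intros x t Dx.
    destruct (proj2 (Himg (v x t, t, weight L x * / u x t, height L x)))
      as [h1 [h2 h3]]; [|simpl in h2, h3; auto].
    exists (x, t, u x t, v x t); split; [simpl; auto | reflexivity]. }
  split; [exact Hd|]; split; [split|].
  - intros x t Dx; rewrite Rplus_0_r; destruct (H1 x t Dx) as [h1 [_ h3]].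
    split; [exact h1|]; rewrite h3; apply (heightK L ok), (Hd x t Dx).
  - intros y s Dy; rewrite Rminus_0_r.
    destruct (proj1 (Himg (y, s, u' y s, v' y s))) as [[[[x t] a] b] [Hg E]].
    { simpl; auto. }
    destruct Hg as [Dx [Ea Eb]]; simpl in Ea, Eb; subst a b.
    injection E as -> -> _ E3; rewrite E3.
    rewrite (heightK L ok); [auto | apply (Hd x t Dx)].
  - intros x t Dx; rewrite Rplus_0_r; apply (H1 x t Dx).
Qed.

Lemma law_point_image_pack (L : law) (D D' : region) (u v u' v' g : field) :
  (forall x t, D (x, t) -> x_dom L x /\ u_dom L (u x t)) ->
  inverse_pair 0 D v D' g ->
  (forall y s, D' (y, s) ->
     u' y s = weight L (g y s) * / u (g y s) s /\ v' y s = height L (g y s)) ->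
  law_point_image L D (u, v) D' (u', v').
Proof.
  intros Hd [H1 H2] H; split; [exact Hd|]; intros [[[y s] a] b]; split.
  - intros [Dy [Ea Eb]]; simpl in Ea, Eb.
    destruct (H2 y s Dy) as [Dg Eg]; rewrite Rminus_0_r in Dg, Eg.
    destruct (H y s Dy) as [E1 E2].
    exists (g y s, s, u (g y s) s, v (g y s) s); split; [simpl; auto|].
    now rewrite Ea, Eb, E1, E2, Eg.
  - intros [[[[x t] a'] b'] [[Dx [Ea Eb]] E]]; simpl in Ea, Eb; subst a' b'.
    injection E as -> -> -> ->.
    destruct (H1 x t Dx) as [Dy Eg]; rewrite Rplus_0_r in Dy, Eg.
    destruct (H _ _ Dy) as [E1 E2]; rewrite Eg in E1, E2; simpl; auto.
Qed.

(** The function x = height_inv(v') of (x', t') has a nonzero derivative in x',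
    so it can in turn be inverted to produce v. *)
Lemma law_diffusion_potential_height_inv (L : law) (ok : hodograph_law L)
    (D' : region) (u' v' : field) :
  open D' -> law_diffusion_potential L D' (u', v') ->
  class_C 2 D' (fun y s => height_inv L (v' y s)) /\
  forall y s, D' (y, s) ->
    let x := height_inv L (v' y s) in
    x_dom L x /\ u' y s / (x * weight L x) <> 0 /\
    differentiable_pt_lim (fun y s => height_inv L (v' y s)) y s
      (u' y s / (x * weight L x)) (law_flux' L u' y s / (x * weight L x)).
Proof.
  intros oD' [Cu' [Cv' H]]; apply C2_on_class_C in Cv'; auto; split.
  - apply (class_C_smooth 2 D' (v'_dom L)); auto; [apply ok | intros; now apply H].
  - intros y s Dy x; destruct (H y s Dy) as [hu' [hv' [E1 E2]]].
    pose proof (height_inv_dom L ok _ hv') as hx.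
    split; [exact hx|]; split.
    + apply Rmult_integral_contrapositive; split; [now apply (u'_neq0 L ok)|].
      apply Rinv_neq_0_compat, Rmult_integral_contrapositive; split;
        [now apply (x_neq0 L ok) | now apply (weight_neq0 L ok)].
    + unfold Rdiv; rewrite (Rmult_comm (u' y s)), (Rmult_comm (law_flux' L u' y s)).
      apply differentiable_pt_lim_smooth; [now apply height_inv_derive|].
      unfold law_flux'; rewrite <- E2, <- E1; apply Cv', Dy.
Qed.

(** From left to right this is [hodograph_forward].  From right to left, v is
    the inverse function of x = height_inv(v'), hence
    v_x = x weight(x) / u' = u x and v_t = - mobility'(u') u'_x' / u', which is
    the flux of u by [flux_relation]. *)
Lemma law_point_solutions (L : law) (ok : hodograph_law L) (D D' : region)
    (w w' : field * field) :
  open D -> open D' -> law_point_image L D w D' w' ->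
  (law_radial_potential L D w <-> law_diffusion_potential L D' w').
Proof.
  destruct w as [u v], w' as [u' v']; intros oD oD' Himg.
  destruct (law_point_image_unpack L ok _ _ _ _ _ _ Himg) as [Hd [HI Huv]].
  assert (Ev : forall y s, D' (y, s) ->
     v'_dom L (v' y s) /\ height L (height_inv L (v' y s)) = v' y s /\
     u'_dom L (u' y s)).
  { intros y s Dy; destruct (proj2 HI y s Dy) as [Dg Eg].
    destruct (Huv _ _ Dg) as [E1 E2]; destruct (Hd _ _ Dg) as [hx hu].
    rewrite Eg in E1, E2; replace (s - 0 + 0) with s in E1, E2 by ring.
    split; [|split; [now symmetry|]].
    - rewrite E2; now apply (height_dom L ok).
    - rewrite E1; now apply (image_dom L ok). }
  split.
  - intros Hsol; pose proof Hsol as [Cu _]; apply C2_on_class_C in Cu; auto.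
    destruct (hodograph_forward L ok D D' u u' v
                (fun y s => height_inv L (v' y s)) 0) as [Cg [Cu' Hpot]]; auto.
    { intros; now apply Huv. }
    { now apply law_radial_potential_differentiable. }
    assert (Hv' : forall y s, D' (y, s) ->
              differentiable_pt_lim v' y s (u' y s) (law_flux' L u' y s)).
    { intros y s Dy.
      apply (differentiable_pt_lim_ext_open D'
               (fun z r => height L (height_inv L (v' z r)))); auto.
      intros; now apply Ev. }
    split; [now apply C2_on_class_C|]; split.
    + apply C2_on_class_C; auto.
      apply (class_C_intro 1 D' v' _ _ oD' Hv'); [now apply class_C_pred|].
      apply class_C_law_flux'; auto; intros; now apply Ev.
    + intros y s Dy; destruct (Ev y s Dy) as [h1 [_ h2]].
      split; [exact h2|]; split; [exact h1|].
      exact (differentiable_pt_lim_D _ _ _ _ _ (Hv' y s Dy)).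
  - intros Hsol.
    destruct (law_diffusion_potential_height_inv L ok D' u' v' oD' Hsol)
      as [Cg Hg].
    pose proof Hsol as [Cu' [_ H']]; apply C2_on_class_C in Cu'; auto.
    set (g := fun y s => height_inv L (v' y s)) in *.
    set (a := fun y s => u' y s / (g y s * weight L (g y s))) in *.
    set (b := fun y s => law_flux' L u' y s / (g y s * weight L (g y s))) in *.
    assert (Hab : forall y s, D' (y, s) -> a y s <> 0 /\
                  differentiable_pt_lim g y s (a y s) (b y s))
      by (intros y s Dy; apply (Hg y s Dy)).
    pose proof (inverse_pair_sym _ _ _ _ _ HI) as HI'.
    assert (Cv : class_C 2 D v).
    { apply (class_C_inverse 1 (- 0) D' D g v (D1 g) (D2 g)); auto; try apply Cg.
      intros y s Dy; destruct (Hab y s Dy) as [ha hg].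
      split; [|apply Cg, Dy].
      now destruct (differentiable_pt_lim_D _ _ _ _ _ hg) as [-> _]. }
    pose proof (inverse_pair_differentiable _ _ _ _ _ a b oD' HI' Hab) as Hv.
    assert (nz : forall x t, D (x, t) -> u' (v x t) (t + 0) <> 0).
    { intros x t Dx; apply (u'_neq0 L ok), H', HI, Dx. }
    assert (Cu : class_C 2 D u).
    { apply (class_C_ext 2 D (fun x t => weight L x * / u' (v x t) (t + 0))); auto.
      - intros x t Dx; rewrite (proj1 (Huv x t Dx)); destruct (Hd x t Dx) as [hx hu].
        pose proof (weight_neq0 L ok _ hx); pose proof (u_neq0 L ok _ hu).
        field; auto.
      - apply (class_C_weight_div L ok 2 D (fun x _ => x)
                 (fun x t => u' (v x t) (t + 0))); auto using class_C_fst.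
        + intros x t Dx; split; [now apply (Hd x t) | auto].
        + apply (class_C_pull 2 D D'); auto; intros; now apply HI. }
    split; [now apply C2_on_class_C|]; split; [now apply C2_on_class_C|].
    intros x t Dx; destruct (Hd x t Dx) as [hx hu].
    pose proof (x_neq0 L ok _ hx) as x0; pose proof (u_neq0 L ok _ hu) as u0.
    pose proof (weight_neq0 L ok _ hx) as w0; pose proof (nz x t Dx) as u'0.
    split; [exact hx|]; split; [exact hu|].
    specialize (Hv x t Dx).
    destruct (proj1 HI x t Dx) as [Dy Eg]; fold g in Eg.
    pose proof (proj1 (Huv x t Dx)) as E1.
    replace (t - - 0) with (t + 0) in Hv by ring.
    unfold a, b in Hv; rewrite Eg in Hv.
    destruct (differentiable_pt_lim_D _ _ _ _ _ Hv) as [-> ->].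
    assert (Ea : / (u' (v x t) (t + 0) / (x * weight L x)) = u x t * x)
      by (rewrite E1; field; auto).
    split; [exact Ea|].
    rewrite Ea in Hv.
    assert (E0 : forall y s, D (y, s) -> u' (v y s) (s + 0) * u y s = weight L y).
    { intros y s Ds; rewrite (proj1 (Huv y s Ds)); field.
      apply (u_neq0 L ok), Hd, Ds. }
    pose proof (flux_relation L ok D u u' v 0 x t _ _ _ _ _ oD Dx hx hu E0 Hv
                  (proj1 Cu x t Dx) (proj1 Cu' _ _ Dy)) as R.
    unfold law_flux' at 1; rewrite R; unfold law_flux; field; auto.
Qed.

Lemma law_point_image_exists (L : law) (ok : hodograph_law L) (D : region)
    (w : field * field) (p : R * R) :
  open D -> law_radial_potential L D w -> D p ->
  exists D0 D' w', open D0 /\ subregion D0 D /\ D0 p /\ open D' /\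
    law_point_image L D0 w D' w'.
Proof.
  destruct w as [u v], p as [x t]; intros oD Hsol Dx.
  pose proof (law_radial_potential_differentiable L D u v oD Hsol) as Hv.
  destruct Hsol as [_ [_ H]].
  destruct (local_inverse D v (fun x t => u x t * x) (law_flux L u) 0 x t oD Dx)
    as [D0 [D' [g [oD0 [h0 [Dx0 [oD' HI]]]]]]].
  { intros y s Dy; split; auto; destruct (H y s Dy) as [hx [hu _]].
    apply Rmult_integral_contrapositive; split;
      [now apply (u_neq0 L ok) | now apply (x_neq0 L ok)]. }
  exists D0, D', (fun y s => weight L (g y s) * / u (g y s) s,
                  fun y s => height L (g y s)).
  do 4 (split; [assumption|]).
  apply law_point_image_pack with g; auto.
  intros y s Dy; destruct (H y s (h0 _ Dy)) as [hx [hu _]]; auto.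
Qed.

Lemma law_point_preimage_exists (L : law) (ok : hodograph_law L) (D' : region)
    (w' : field * field) (p' : R * R) :
  open D' -> law_diffusion_potential L D' w' -> D' p' ->
  exists D0' D w, open D0' /\ subregion D0' D' /\ D0' p' /\ open D /\
    law_point_image L D w D0' w'.
Proof.
  destruct w' as [u' v'], p' as [y s]; intros oD' Hsol Dy.
  destruct (law_diffusion_potential_height_inv L ok D' u' v' oD' Hsol) as [_ Hg].
  destruct Hsol as [_ [_ H]].
  set (g := fun y s => height_inv L (v' y s)) in *.
  destruct (local_inverse D' g (fun y s => u' y s / (g y s * weight L (g y s)))
              (fun y s => law_flux' L u' y s / (g y s * weight L (g y s)))
              0 y s oD' Dy)
    as [D0' [D [v [oD0 [h0 [Dy0 [oD HI]]]]]]].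
  { intros z r Dz; apply (Hg z r Dz). }
  apply inverse_pair_sym in HI; rewrite Ropp_0 in HI.
  exists D0', D, (fun x t => weight L x * / u' (v x t) t, v).
  do 4 (split; [assumption|]).
  apply law_point_image_pack with g; auto.
  - intros x t Dx; destruct (proj1 HI x t Dx) as [Dv Ev].
    rewrite Rplus_0_r in Dv, Ev; apply h0 in Dv.
    assert (hx : x_dom L x) by (rewrite <- Ev; apply (Hg _ _ Dv)).
    split; [exact hx | apply (preimage_dom L ok); auto; apply (H _ _ Dv)].
  - intros z r Dz; destruct (proj2 HI z r Dz) as [_ Ev]; rewrite Rminus_0_r in Ev.
    apply h0 in Dz; destruct (H z r Dz) as [hu [hv _]]; rewrite Ev; split.
    + pose proof (u'_neq0 L ok _ hu).
      pose proof (weight_neq0 L ok _ (proj1 (Hg z r Dz))).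
      field; auto.
    + symmetry; apply (height_invK L ok), hv.
Qed.

Lemma law_contact_of_point (L : law) (ok : hodograph_law L) (D D' : region)
    (u v u' v' : field) :
  open D -> law_radial_potential L D (u, v) ->
  law_point_image L D (u, v) D' (u', v') ->
  law_contact L (law_flux L u) v (fun _ t => t) D u D' u'.
Proof.
  intros oD Hsol Himg.
  destruct (law_point_image_unpack L ok _ _ _ _ _ _ Himg) as [Hd [HI Huv]].
  split; [exact Hd|]; split.
  - intros x t Dx; split; [|apply differentiable_pt_lim_snd].
    now apply (law_radial_potential_differentiable L D).
  - intros y s z; split.
    + intros [Dy ->]; destruct (proj2 HI y s Dy) as [Dg Eg].
      destruct (Huv _ _ Dg) as [E _]; rewrite Eg in E.
      replace (s - 0 + 0) with s in E by ring; rewrite Rminus_0_r in *.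
      exists (height_inv L (v' y s)), s; auto.
    + intros [x [t [Dx [-> [-> ->]]]]].
      destruct (proj1 HI x t Dx) as [Dy _]; destruct (Huv x t Dx) as [E _].
      rewrite Rplus_0_r in *; auto.
Qed.

(** A local potential v of u x dx + flux dt completes u to a solution of the
    potential system, to which the point transformation applies. *)
Lemma law_contact_exists (L : law) (ok : hodograph_law L) (D : region)
    (u : field) (p : R * R) :
  open D -> law_radial L D u -> D p ->
  exists D0 D' u', open D0 /\ subregion D0 D /\ D0 p /\ open D' /\
    exists X T, law_contact L (law_flux L u) X T D0 u D' u'.
Proof.
  destruct p as [x t]; intros oD [Cu H] Dx.
  assert (Cu2 := Cu); apply C2_on_class_C in Cu2; auto.
  assert (Hd : forall x t, D (x, t) -> x_dom L x /\ u_dom L (u x t))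
    by (intros y s Dy; destruct (H y s Dy) as [h1 [h2 _]]; auto).
  assert (Ca : class_C 1 D (fun x t => u x t * x))
    by (apply class_C_mult; auto using class_C_fst; now apply class_C_pred).
  assert (Cb : class_C 1 D (law_flux L u))
    by (apply class_C_law_flux; auto; [intros; now apply Hd
          | now apply class_C_pred | apply Cu2]).
  destruct (local_potential D _ _ x t oD Dx Ca Cb) as [d [v [hd [hD [_ Hv]]]]].
  { intros y s Dy; apply (radial_closed L ok D); auto; apply (H y s Dy). }
  pose proof (box_open x t d) as oB.
  assert (Hsol : law_radial_potential L (box x t d) (u, v)).
  { split; [intros y s By; apply Cu, hD, By|]; split.
    - apply C2_on_class_C; auto.
      apply (class_C_intro 1 _ v _ _ oB Hv); now apply (class_C_sub 1 D).
    - intros y s By; destruct (Hd y s (hD _ By)); do 2 (split; [assumption|]).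
      exact (differentiable_pt_lim_D _ _ _ _ _ (Hv y s By)). }
  destruct (law_point_image_exists L ok _ _ (x, t) oB Hsol (box_center x t d hd))
    as [D0 [D' [[u' v'] [oD0 [h0 [Dx0 [oD' Himg]]]]]]].
  exists D0, D', u'; split; [exact oD0|]; split; [intros q Dq; auto|].
  do 2 (split; [assumption|]); exists v, (fun _ t => t).
  apply (law_contact_of_point L ok D0 D' u v u' v'); auto.
  now apply (law_radial_potential_sub L (box x t d)).
Qed.

Lemma law_contact_preimage_exists (L : law) (ok : hodograph_law L) (D' : region)
    (u' : field) (p' : R * R) :
  open D' -> law_diffusion L D' u' -> D' p' ->
  exists D0' D u, open D0' /\ subregion D0' D' /\ D0' p' /\ open D /\
    C2_on D u /\
    exists X T, law_contact L (law_flux L u) X T D u D0' u'.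
Proof.
  destruct p' as [y s]; intros oD' [Cu H] Dy.
  assert (Cu2 := Cu); apply C2_on_class_C in Cu2; auto.
  assert (Cb : class_C 1 D' (law_flux' L u'))
    by (apply class_C_law_flux'; auto; intros; now apply H).
  destruct (local_potential D' u' (law_flux' L u') y s oD' Dy)
    as [d [f [hd [hD [Ef Hf]]]]]; auto using class_C_pred.
  { intros z r Dz; apply (H z r Dz). }
  (* The additive constant places the potential in the range of the height. *)
  set (v' := fun z r => f z r + height L 1).
  assert (Hv' : forall z r, box y s d (z, r) ->
                differentiable_pt_lim v' z r (u' z r) (law_flux' L u' z r)).
  { intros z r Bz; replace (u' z r) with (u' z r + 0) by ring.
    replace (law_flux' L u' z r) with (law_flux' L u' z r + 0) by ring.
    apply (differentiable_pt_lim_plus f (fun _ _ => height L 1)); auto.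
    apply (differentiable_pt_lim_proj1_0 (fun _ => height L 1)),
      derivable_pt_lim_const. }
  set (B := fun q : R * R => box y s d q /\ v'_dom L (v' (fst q) (snd q))).
  assert (oB : open B).
  { apply open_preimage; [apply box_open | | apply ok].
    intros z r Bz; exact (differentiable_pt_lim_continuity _ _ _ _ _ (Hv' z r Bz)). }
  assert (By : B (y, s)).
  { split; [now apply box_center|]; unfold v'; simpl; rewrite Ef, Rplus_0_l.
    apply (height_dom L ok), (x_one L ok). }
  assert (Hsol : law_diffusion_potential L B (u', v')).
  { split; [intros z r Bz; apply Cu, hD, Bz|]; split.
    - apply C2_on_class_C; auto.
      apply (class_C_intro 1 B v' u' (law_flux' L u') oB).
      + intros z r Bz; apply Hv', Bz.
      + apply (class_C_sub 1 D'); [intros q Bq; apply hD, Bq | now apply class_C_pred].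
      + apply (class_C_sub 1 D'); [intros q Bq; apply hD, Bq | exact Cb].
    - intros z r Bz; split; [apply (H z r), hD, Bz|]; split; [apply Bz|].
      exact (differentiable_pt_lim_D _ _ _ _ _ (Hv' z r (proj1 Bz))). }
  destruct (law_point_preimage_exists L ok B _ (y, s) oB Hsol By)
    as [D0' [D [[u v] [oD0 [h0 [Dy0 [oD Himg]]]]]]].
  assert (Hrad : law_radial_potential L D (u, v)).
  { apply (law_point_solutions L ok D D0' _ (u', v')); auto.
    now apply (law_diffusion_potential_sub L B). }
  exists D0', D, u; split; [exact oD0|].
  split; [intros q Dq; apply hD, (h0 q Dq)|].
  do 2 (split; [assumption|]); split; [apply Hrad|].
  exists v, (fun _ t => t); now apply (law_contact_of_point L ok D D0' u v u' v').
Qed.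

(** * The two laws *)

(** The case of arbitrary n, in which all powers are taken of positive
    quantities. *)
Definition power_law (n mu : R) : law := {|
  x_dom := fun x => 0 < x;
  u_dom := fun u => 0 < u;
  u'_dom := fun u => 0 < u;
  v'_dom := fun y => 0 < 2 * (n + 1) / (n + 2) * y;
  mobility := fun u => Rpower u n;
  drift := fun u => (mu - 1) / (n + 1) * Rpower u (n + 1);
  mobility' := fun u => Rpower u (- (n + 2));
  weight := fun x => Rpower x (- (2 / (n + 2)));
  height := fun x => (n + 2) / (2 * (n + 1)) * Rpower x (2 * (n + 1) / (n + 2));
  height_inv := fun y =>
    Rpower (2 * (n + 1) / (n + 2) * y) ((n + 2) / (2 * (n + 1)));
  law_mu := mu |}.

(** The case n = 0, in which every exponent is an integer and signs are
    arbitrary. *)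
Definition reciprocal_law : law := {|
  x_dom := fun x => x <> 0;
  u_dom := fun u => u <> 0;
  u'_dom := fun u => u <> 0;
  v'_dom := fun y => y <> 0;
  mobility := fun _ => 1;
  drift := fun u => u;
  mobility' := fun u => / u ^ 2;
  weight := fun x => / x;
  height := fun x => x;
  height_inv := fun y => y;
  law_mu := 2 |}.

Lemma Rpower_pos (x a : R) : 0 < Rpower x a.
Proof. apply exp_pos. Qed.

Lemma Rpower_inv (x a : R) : 0 < x -> Rpower (/ x) a = Rpower x (- a).
Proof.
  intros hx; unfold Rpower; rewrite ln_Rinv by exact hx; f_equal; ring.
Qed.

Lemma Rpower_two (x : R) : 0 < x -> Rpower x 2 = x * x.
Proof.
  intros hx; replace 2 with (1 + 1) by ring; now rewrite Rpower_plus, Rpower_1.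
Qed.

Lemma open_scaled_pos (k : R) : open (fun y : R => 0 < k * y).
Proof.
  apply (open_comp (fun y : R => k * y) (fun z => 0 < z)); [|exact open_pos].
  intros y _; apply (filterlim_scal_r k y).
Qed.

Lemma power_hodograph_law (n mu : R) :
  n <> -2 -> n <> -1 -> mu = (3 * n + 4) / (n + 2) ->
  hodograph_law (power_law n mu).
Proof.
  intros hn2 hn1 hmu.
  assert (h1 : n + 1 <> 0) by lra; assert (h2 : n + 2 <> 0) by lra.
  set (k := 2 * (n + 1) / (n + 2)).
  assert (hk : k <> 0).
  { unfold k, Rdiv; apply Rmult_integral_contrapositive; split;
      [lra | now apply Rinv_neq_0_compat]. }
  assert (Ek : (n + 2) / (2 * (n + 1)) = / k) by (unfold k; field; auto).
  assert (Emu : mu - 1 = k) by (rewrite hmu; unfold k; field; auto).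
  split; simpl; fold k; rewrite ?Ek, ?Emu.
  - exact open_pos.
  - exact open_pos.
  - exact open_pos.
  - apply open_scaled_pos.
  - intros; lra.
  - intros; lra.
  - intros; lra.
  - intros x hx; pose proof (Rpower_pos x (- (2 / (n + 2)))); lra.
  - lra.
  - apply smooth_Rpower.
  - apply smooth_mult; [exact open_pos | apply smooth_const, open_pos
                       | apply smooth_Rpower].
  - apply smooth_Rpower.
  - apply smooth_Rpower.
  - apply smooth_mult; [exact open_pos | apply smooth_const, open_pos
                       | apply smooth_Rpower].
  - apply (smooth_comp _ (fun x => 0 < x) (fun x => Rpower x (/ k))
             (fun y => k * y)); auto using open_scaled_pos, smooth_Rpower.
    apply smooth_mult; auto using open_scaled_pos, smooth_const, smooth_id.
  - intros u hu.
    replace (k * Rpower u n)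
      with (k / (n + 1) * ((n + 1) * Rpower u (n + 1 - 1))).
    + apply is_derive_scal, is_derive_Rpower, hu.
    + replace (n + 1 - 1) with n by ring; field; auto.
  - intros x u hx hu; rewrite (is_derive_unique _ _ _ (is_derive_Rpower _ x hx)).
    replace (- (2 / (n + 2)) - 1) with (- (2 / (n + 2)) + - (1)) by ring.
    rewrite !Rpower_plus, !Rpower_Ropp, !Rpower_1 by assumption.
    unfold k; field; repeat split; auto; try lra.
    apply Rgt_not_eq, Rpower_pos.
  - intros x hx.
    replace (x * Rpower x (- (2 / (n + 2))))
      with (/ k * (k * Rpower x (k - 1))).
    + apply is_derive_scal, is_derive_Rpower, hx.
    + rewrite <- Rmult_assoc, Rinv_l, Rmult_1_l by exact hk.
      replace (k - 1) with (1 + - (2 / (n + 2))) by (unfold k; field; auto).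
      now rewrite Rpower_plus, Rpower_1.
  - intros x u hx hu; apply Rmult_lt_0_compat;
      [apply Rpower_pos | now apply Rinv_0_lt_compat].
  - intros x u hx hu; apply Rmult_lt_0_compat;
      [apply Rpower_pos | now apply Rinv_0_lt_compat].
  - intros x u hx hu.
    rewrite <- Rpower_mult_distr by (apply Rpower_pos || now apply Rinv_0_lt_compat).
    rewrite Rpower_inv, Rpower_mult by exact hu.
    replace (- (2 / (n + 2)) * - (n + 2)) with 2 by (field; auto).
    replace (- - (n + 2)) with (2 + n) by ring.
    rewrite Rpower_plus, !Rpower_two by assumption; ring.
  - intros x hx; rewrite <- Rmult_assoc, Rinv_r, Rmult_1_l by exact hk.
    apply Rpower_pos.
  - intros x hx; rewrite <- Rmult_assoc, Rinv_r, Rmult_1_l by exact hk.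
    rewrite Rpower_mult, Rinv_r by exact hk; now apply Rpower_1.
  - intros y hy; apply Rpower_pos.
  - intros y hy; rewrite Rpower_mult, Rinv_l, Rpower_1 by assumption.
    field; exact hk.
Qed.

Lemma reciprocal_hodograph_law : hodograph_law reciprocal_law.
Proof.
  assert (id_smooth : smooth (fun x => x <> 0) (fun x => x))
    by apply smooth_id, open_neq0.
  assert (inv_nz : forall x y, x <> 0 -> y <> 0 -> / x * / y <> 0)
    by (intros; apply Rmult_integral_contrapositive; split;
        now apply Rinv_neq_0_compat).
  split; simpl; auto using open_neq0, smooth_inv.
  - intros; now apply Rinv_neq_0_compat.
  - apply smooth_const, open_neq0.
  - apply (smooth_comp _ (fun x => x <> 0) Rinv (fun u => u * (u * 1)));
      auto using open_neq0, smooth_inv.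
    apply smooth_mult; auto using open_neq0.
    apply smooth_mult; auto using open_neq0, smooth_const.
  - intros u hu; replace ((2 - 1) * 1) with 1 by ring; apply @is_derive_id.
  - intros x u hx hu.
    assert (H : is_derive (fun y : R => / y) x (- / x ^ 2))
      by (auto_derive; [exact hx | field; exact hx]).
    rewrite (is_derive_unique _ _ _ H); field; exact hx.
  - intros x hx; rewrite Rinv_r by exact hx; apply @is_derive_id.
  - intros x u hx hu; field; auto.
Qed.

Lemma linear_equation_law (D : region) (u : field) :
  linear_equation D u <-> law_radial reciprocal_law D u.
Proof.
  assert (E : forall x t, D1 (fun y s => 1 * D1 u y s) x t = D1 (D1 u) x t).
  { intros x t; apply Derive_ext; intros y; ring. }
  split; intros [Cu H]; (split; [exact Cu|]); intros x t Dx;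
    destruct (H x t Dx) as [hx [hu Eu]]; do 2 (split; [assumption|]);
    simpl in *; rewrite Eu, E; ring.
Qed.

(** For n = 0 the flux is (x u)_x wherever u is differentiable. *)
Lemma reciprocal_flux (u : field) (x t : R) :
  ex_derive (fun y => u y t) x ->
  D1 (fun y s => y * u y s) x t = law_flux reciprocal_law u x t.
Proof.
  intros Hu; apply is_derive_unique; unfold law_flux; simpl.
  replace (x * 1 * D1 u x t + u x t) with (1 * u x t + x * D1 u x t) by ring.
  apply (is_derive_mult (fun y => y) (fun y => u y t)).
  - apply @is_derive_id.
  - apply Derive_correct, Hu.
  - intros; apply Rmult_comm.
Qed.

Lemma law_contact_ext (L : law) (b b' X T : field) (D D' : region) (u u' : field) :
  (forall x t, D (x, t) -> b x t = b' x t) ->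
  law_contact L b X T D u D' u' -> law_contact L b' X T D u D' u'.
Proof.
  intros E [Hd [HX H]]; split; [exact Hd|]; split; [|exact H].
  intros x t Dx; rewrite <- E by exact Dx; now apply HX.
Qed.

Lemma C2_on_ex_derive (D : region) (u : field) (x t : R) :
  C2_on D u -> D (x, t) -> ex_derive (fun y => u y t) x.
Proof. intros Cu Dx; apply (Cu x t Dx). Qed.

Lemma connects_potential_systems (n mu : R) (ok : hodograph_law (power_law n mu)) :
  connects (point_image n)
    (radial_potential_system n mu) (diffusion_potential_system n).
Proof.
  split; [|split].
  - exact (law_point_solutions _ ok).
  - exact (law_point_image_exists _ ok).
  - exact (law_point_preimage_exists _ ok).
Qed.

Lemma connects_equations (n mu : R) (ok : hodograph_law (power_law n mu)) :
  connects (fun D u D' u' => exists X T, contact_image n mu X T D u D' u')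
    (radial_diffusion n mu) (diffusion n).
Proof.
  split; [|split].
  - intros D D' u u' oD oD' [X [T H]].
    now apply (law_contact_solutions _ ok (flux n mu u) X T).
  - exact (law_contact_exists _ ok).
  - intros D' u' p' oD' Hsol Dp.
    destruct (law_contact_preimage_exists _ ok D' u' p' oD' Hsol Dp)
      as [D0' [D [u [h1 [h2 [h3 [h4 [_ h5]]]]]]]].
    now exists D0', D, u.
Qed.

Lemma connects_linear_equation :
  connects (fun D u D' u' => exists X T, contact_image0 X T D u D' u')
    linear_equation inverse_square_diffusion.
Proof.
  assert (ok := reciprocal_hodograph_law).
  split; [|split].
  - intros D D' u u' oD oD' [X [T H]]; rewrite linear_equation_law.
    apply (law_contact_solutions _ ok (D1 (fun y s => y * u y s)) X T); auto.
    intros; now apply reciprocal_flux.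
  - intros D u p oD Hsol Dp; apply linear_equation_law in Hsol.
    destruct (law_contact_exists _ ok D u p oD Hsol Dp)
      as [D0 [D' [u' [h1 [h2 [h3 [h4 [X [T H]]]]]]]]].
    exists D0, D', u'; do 4 (split; [assumption|]); exists X, T.
    apply (law_contact_ext reciprocal_law _ (D1 (fun y s => y * u y s))) in H; auto.
    intros x t Dx; symmetry; apply reciprocal_flux.
    apply (C2_on_ex_derive D); [apply Hsol | auto].
  - intros D' u' p' oD' Hsol Dp.
    destruct (law_contact_preimage_exists _ ok D' u' p' oD' Hsol Dp)
      as [D0' [D [u [h1 [h2 [h3 [h4 [Cu [X [T H]]]]]]]]]].
    exists D0', D, u; do 4 (split; [assumption|]); exists X, T.
    apply (law_contact_ext reciprocal_law _ (D1 (fun y s => y * u y s))) in H; auto.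
    intros x t Dx; symmetry; apply reciprocal_flux.
    now apply (C2_on_ex_derive D).
Qed.

(** On positive quantities, the general contact transformation at n = 0 is the
    special one. *)
Lemma contact_image_reciprocal (X T : field) (D D' : region) (u u' : field) :
  C2_on D u -> contact_image 0 2 X T D u D' u' -> contact_image0 X T D u D' u'.
Proof.
  intros Cu [Hd [HX H]].
  assert (Ew : forall x t, D (x, t) ->
     Rpower x (- (2 / (0 + 2))) * / u x t = / x * / u x t).
  { intros x t Dx; destruct (Hd x t Dx) as [hx _].
    replace (2 / (0 + 2)) with 1 by field.
    now rewrite Rpower_Ropp, Rpower_1. }
  split; [|split].
  - intros x t Dx; destruct (Hd x t Dx); split; lra.
  - intros x t Dx; rewrite (reciprocal_flux u x t (C2_on_ex_derive D u x t Cu Dx)).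
    replace (law_flux reciprocal_law u x t) with (flux 0 2 u x t); [now apply HX|].
    destruct (Hd x t Dx) as [_ hu]; unfold flux, law_flux; simpl.
    rewrite Rplus_0_l, Rpower_O, Rpower_1 by exact hu; field.
  - intros y s z; rewrite H; split; intros [x [t [Dx [-> [-> ->]]]]];
      exists x, t; rewrite (Ew x t Dx); auto.
Qed.

Theorem mainTheorem16 (n mu : R) (hn2 : n <> -2) (hn1 : n <> -1)
    (hmu : mu = (3 * n + 4) / (n + 2)) :
  (* the point transformation connects the two potential systems *)
  connects (point_image n)
    (radial_potential_system n mu) (diffusion_potential_system n)
  /\
  (* it leads to the contact transformation, with x' = v and t' = t *)
  (forall (D D' : region) (u v u' v' : field),
     open D -> open D' ->
     radial_potential_system n mu D (u, v) ->
     point_image n D (u, v) D' (u', v') ->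
     contact_image n mu v (fun _ t => t) D u D' u')
  /\
  (* the contact transformation connects the two equations *)
  connects (fun D u D' u' => exists X T, contact_image n mu X T D u D' u')
    (radial_diffusion n mu) (diffusion n)
  /\
  (* the case n = 0 *)
  (n = 0 ->
     (forall (D D' : region) (u v u' v' : field),
        open D -> open D' ->
        radial_potential_system n mu D (u, v) ->
        point_image n D (u, v) D' (u', v') ->
        contact_image0 v (fun _ t => t) D u D' u')
     /\
     connects (fun D u D' u' => exists X T, contact_image0 X T D u D' u')
       linear_equation inverse_square_diffusion).
Proof.
  assert (ok := power_hodograph_law n mu hn2 hn1 hmu).
  assert (Hpc : forall (D D' : region) (u v u' v' : field),
     open D -> open D' -> radial_potential_system n mu D (u, v) ->
     point_image n D (u, v) D' (u', v') ->
     contact_image n mu v (fun _ t => t) D u D' u').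
  { intros D D' u v u' v' oD _.
    exact (law_contact_of_point _ ok D D' u v u' v' oD). }
  split; [now apply connects_potential_systems|]; split; [exact Hpc|].
  split; [now apply connects_equations|]; intros n0.
  split; [|exact connects_linear_equation].
  intros D D' u v u' v' oD oD' Hsol Himg; apply contact_image_reciprocal.
  - apply Hsol.
  - replace 2 with mu by (rewrite hmu, n0; field); rewrite <- n0.
    now apply (Hpc D D' u v u' v').
Qed.
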